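(* For all natural numbers $m$ and $\lambda$ there exists a natural number $f(m,\lambda)$ such that the following holds. If $b\ge 0$ and $m_1,\ldots,m_{b+1}$ are positive integers with $m=m_1+\cdots+m_{b+1}$, and $G$ is an $f(m,\lambda)$-edge-connected bipartite graph on vertex classes $A$ and $B$ in which every vertex of $A$ has degree divisible by $m$, then $G$ can be decomposed (its edge set partitioned) into $b+1$ spanning $\lambda$-edge-connected graphs $G_1,\ldots,G_{b+1}$ such that (i) $d(v,G_i)=\frac{m_i}{m}d(v,G)$ for all $v\in A$ and $i\in\{1,\ldots,b+1\}$, and (ii) $d(v,G_i)$ is divisible by $m_i$ for all $v\in B$ and $i\in\{1,\ldots,b\}$.
   Context: All graphs are finite and loopless but may have multiple edges. $d(v,H)$ denotes the degree of vertex $v$ in $H$. *)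

(* Defs.v *)
(* Finite loopless multigraphs given by an edge type E and
   two endpoint maps s t : E -> V (orientation irrelevant). Subgraphs on the
   same vertex set V (spanning) are given by edge sets F : {set E}. *)
From mathcomp Require Import all_boot.
Set Implicit Arguments. Unset Strict Implicit. Unset Printing Implicit Defensive.

Section MultiGraph.
Variables (V E : finType) (s t : E -> V).

Definition loopless : Prop := forall e : E, s e != t e.

Definition incident (e : E) (v : V) : bool := (s e == v) || (t e == v).

(* d(v, H) for the spanning subgraph H = (V, F); loopless so each incident
   edge counts once *)
Definition deg (F : {set E}) (v : V) : nat := #|[set e in F | incident e v]|.

Definition adj (F : {set E}) : rel V :=
  fun u w => [exists e in F, ((s e == u) && (t e == w)) || ((s e == w) && (t e == u))].

Definition connectedG (F : {set E}) : Prop := forall u w : V, connect (adj F) u w.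

Definition edge_conn (k : nat) (F : {set E}) : Prop :=
  forall D : {set E}, D \subset F -> #|D| < k -> connectedG (F :\: D).

Definition bipartite_on (A : {set V}) : Prop :=
  forall e : E, (s e \in A) != (t e \in A).

End MultiGraph.

(* Main.v *)
(** Split off one colour class at a time; it is enough to cut F into H and F \ H
    with degree ratio m1 : m2 on A and m1-divisible degrees of H off A.
    - Matroid intersection (sums of graphic matroids against a partition matroid)
      yields many edge-disjoint spanning trees using only a small share of the
      edges at every vertex of A.  Some go to H, some to F \ H, and keep both
      highly connected.
    - The other edges first get a fractional share x(e), bounded away from 0 and
      1, with the right sums on A.  At every vertex of A the edges of one tree
      are arranged in a cycle, and consecutive edges are read as one edge between
      vertices outside A; this auxiliary graph has large cuts.  Orienting it with
      prescribed out-degrees modulo D * m1 gives a bounded correction of x which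
      cancels on A and makes the sums off A divisible.  Since the graph is
      bipartite, the corrected x can be rounded without changing vertex sums.
    - Graphs with large cuts have orientations with prescribed out-degrees modulo
      K.  This follows the minimal counterexample argument of Lovasz, Thomassen,
      Wu and Zhang (contracting small cuts, splitting off pairs of edges,
      deleting vertices), with generous constants that make Mader's splitting
      theorem unnecessary. *)
Require Import Defs.
From mathcomp Require Import all_boot all_order all_algebra zify ring.
Set Implicit Arguments. Unset Strict Implicit. Unset Printing Implicit Defensive.
Import Order.TTheory GRing.Theory Num.Theory.

Local Open Scope ring_scope.

(** * Modulo orientations *)

(** The obstacle is that degrees on [A] are prescribed exactly but degrees off [A] only modulo [m1].
    A correction must cancel at every vertex of [A]; pairing the edges there leaves a purely modular
    problem on the other side. Shares are counted in units of 1 / [D] with [D] = 2m. Rounding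
    divides all vertex sums by [D], so divisibility by [m1] has to be prepared modulo [D] * [m1].
    The demands are compatible for free: their total is [D] times the size that [H] must have, which
    is a multiple of [D] * [m1]. A correction moves a share by at most one unit, hence shares
    between 1 and [D] - 1. In the orientation theorem, cuts around two or more vertices are treated
    apart from degrees of single vertices. After the small cuts are contracted the former exceed
    [C0], nearly twice [C1], and stay large enough in each later reduction, so edges to split off
    can be chosen by multiplicity alone. Only the degrees of single vertices need exact accounting,
    against [C1] plus the distance of the demand to the multiples of the modulus. *)

Lemma exists_subset_card (T : finType) (A : {set T}) n : (n <= #|A|)%N ->
  exists2 B : {set T}, B \subset A & #|B| = n.
Proof.
move=> hn; exists [set x in take n (enum A)].
  by apply/subsetP=> y; rewrite inE => /mem_take; rewrite mem_enum.
rewrite cardsE (card_uniqP _) ?take_uniq ?enum_uniq // size_takel // -cardE //.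
Qed.

Lemma sum_const_int (T : finType) (A : {set T}) (c : int) : \sum_(y in A) c = c * #|A|%:Z.
Proof. by rewrite sumr_const -mulr_natr natz. Qed.

(** The distance from [r] to the nearest multiple of [M]. *)
Definition dist_mod (M r : int) : int := Num.min (r %% M)%Z (M - (r %% M)%Z).

Lemma dist_mod_le (M r y q : int) : 0 < M -> r = y + q * M -> dist_mod M r <= `|y|.
Proof.
move=> M0 er; rewrite /dist_mod.
have ed := divz_eq r M; have a0 := modz_ge0 r (lt0r_neq0 M0).
have aM := ltz_pmod r M0.
set a := (r %% M)%Z in ed a0 aM *; set d := (r %/ M)%Z in ed.
have ey : y = (d - q) * M + a by lia.
have [t0|t1|t1] := ltgtP (d - q) 0.
- have : (d - q) * M <= - M by nia.
  lia.
- have : (d - q) * M >= M by nia.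
  lia.
- lia.
Qed.

Lemma dist_modP (K r : int) : 0 < K ->
  [/\ 0 <= dist_mod (2 * K) r, dist_mod (2 * K) r <= K &
   exists s q, (s = 1 \/ s = -1) /\ r = s * dist_mod (2 * K) r + q * (2 * K)].
Proof.
move=> K0; have M0 : 0 < 2 * K by lia.
rewrite /dist_mod.
have ed := divz_eq r (2 * K); have a0 := modz_ge0 r (lt0r_neq0 M0).
have aM := ltz_pmod r M0.
set a := (r %% (2 * K))%Z in ed a0 aM *; set d := (r %/ (2 * K))%Z in ed.
split; [lia | lia |].
have [le|lt] := leP a (2 * K - a).
- exists 1, d; split; [by left | lia].
- exists (-1), (d + 1); split; [by right | lia].
Qed.

Lemma sign_parity (a b : int) : `|a| <= 1 -> b = 1 \/ b = -1 -> (2 %| `|a| - b * a)%Z.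
Proof. by move=> ha [] ->; lia. Qed.

(** * Edges as vectors: cuts, degrees, multiplicities *)

Section Graph.
Variables (V E : finType).
Implicit Types (x f r : V -> int) (S T W : {set V}) (i : E -> V -> int).

Definition vsum x S : int := \sum_(v in S) x v.

(* Edges are vectors V -> int.  On a vertex set W the predicate [edgev] singles out
   the vectors 0 (a deleted edge or a loop) and chi_u - chi_v (an oriented edge),
   in a form that contraction visibly preserves. *)
Definition edgev W x := (forall S, S \subset W -> `|vsum x S| <= 1) /\ vsum x W = 0.

Definition cut i S : int := \sum_e `|vsum (i e) S|.

Definition outflow (phi : E -> int) i v : int := \sum_e phi e * i e v.

Lemma vsum1 x v : vsum x [set v] = x v.
Proof. by rewrite /vsum big_set1. Qed.

Lemma vsumU x S T : [disjoint S & T] -> vsum x (S :|: T) = vsum x S + vsum x T.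
Proof. by move=> d; rewrite /vsum -bigU; [apply: eq_bigl => v; rewrite !inE |]. Qed.

Lemma vsumU1 x v S : v \notin S -> vsum x (v |: S) = x v + vsum x S.
Proof. by move=> d; rewrite /vsum big_setU1. Qed.

Lemma vsumD1 x v S : v \in S -> vsum x S = x v + vsum x (S :\ v).
Proof. by move=> d; rewrite /vsum (big_setD1 v). Qed.

Lemma vsumD x S W : S \subset W -> vsum x W = vsum x S + vsum x (W :\: S).
Proof. by move=> d; rewrite /vsum (big_setID S) /= (setIidPr d). Qed.

Lemma edgev0 W : edgev W (fun=> 0).
Proof.
have h S : vsum (fun=> 0) S = 0 by rewrite /vsum big1.
by split=> [S _|]; rewrite h.
Qed.

Lemma edgev1 W x v : edgev W x -> v \in W -> `|x v| <= 1.
Proof. by case=> h _ vW; rewrite -vsum1; apply: h; rewrite sub1set. Qed.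

Lemma edgev_two W x u v : edgev W x -> u \in W -> v \in W -> u != v ->
  [/\ `|x u| <= 1, `|x v| <= 1 & `|x u + x v| <= 1].
Proof.
move=> h uW vW ne; split; try exact: edgev1 h _.
case: h => h _; move: (h [set u; v]); rewrite vsumU1 ?inE // vsum1; apply.
by apply/subsetP=> w; rewrite !inE => /orP[]/eqP->.
Qed.

Lemma edgev_cases W x S v : edgev W x -> v \in W -> S \subset W -> v \notin S ->
  [/\ `|vsum x S| <= 1, `|x v| <= 1 & `|x v + vsum x S| <= 1].
Proof.
move=> h vW sW vS; split; [by case: h => h _; apply: h | exact: edgev1 h _ |].
case: h => h _; rewrite -vsumU1 //; apply: h.
by apply/subsetP=> w; rewrite !inE => /orP[/eqP->|/(subsetP sW)].
Qed.

(** The zero sum forces a second nonzero coordinate, and the bounds on sets of two and three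
    vertices force it to be opposite and the last one. So the set-wise conditions in [edgev] do
    describe a single edge. *)
Lemma other_end W x v : edgev W x -> v \in W -> x v != 0 ->
  exists2 u, u \in W :\ v & x u = - x v /\ forall w, w \in W -> w != v -> w != u -> x w = 0.
Proof.
move=> h vW nz.
have [u uW nzu] : exists2 u, u \in W :\ v & x u != 0.
  case: (pickP (fun u => (u \in W :\ v) && (x u != 0))) => [u /andP[]|h0]; first by exists u.
  have : vsum x W = x v.
    rewrite (vsumD1 _ vW) /vsum big1 ?addr0 // => u uW.
    by move: (h0 u); rewrite uW /= => /negbFE/eqP.
  by case: h => _ -> e; rewrite -e eqxx in nz.
exists u => //; move: uW; rewrite !inE => /andP[nuv uW].
have [h1 h2 h3] := edgev_two h uW vW nuv.
have h4 := edgev1 h vW.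
split=> [|w wW nwv nwu]; first by lia.
case: (h) => hS _; move: (hS [set w; u; v]); rewrite setUC.
rewrite vsumU1 ?inE ?negb_or; last by rewrite eq_sym nwv eq_sym.
rewrite vsumU1 ?inE // vsum1 => h5.
have [] := edgev_two h wW vW nwv; have [] := edgev_two h wW uW nwu.
have : `|x v + (x w + x u)| <= 1.
  apply: h5; apply/subsetP=> y; rewrite !inE => /orP[/eqP->//|/orP[]/eqP->//].
lia.
Qed.

Lemma edgev_unit W (y : V -> int) v : edgev W y -> v \in W -> y v != 0 -> y v = 1 \/ y v = -1.
Proof. by move=> h vW; move: (edgev1 h vW); clear; lia. Qed.

Lemma cut1 i v : cut i [set v] = \sum_e `|i e v|.
Proof. by apply: eq_bigr => e _; rewrite vsum1. Qed.

Lemma cut_compl i W S : (forall e, edgev W (i e)) -> S \subset W -> cut i (W :\: S) = cut i S.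
Proof.
move=> h sW; apply: eq_bigr => e _; case: (h e) => _; rewrite (vsumD _ sW); lia.
Qed.

Lemma dvdz_sum (I : finType) (P : pred I) (F : I -> int) (d : int) :
  (forall j, P j -> (d %| F j)%Z) -> (d %| \sum_(j | P j) F j)%Z.
Proof. by move=> h; apply: (big_ind (fun y => (d %| y)%Z)) => // a b; apply: rpredD. Qed.

(** Modulo 2 an edge contributes equally to the degree sum over [S] and to the cut. Thus the parity
    condition at vertices passes to sets, hence to contracted vertices. *)
Lemma cut_parity i r S : (forall v, v \in S -> (2 %| r v - cut i [set v])%Z) ->
  (2 %| vsum r S - cut i S)%Z.
Proof.
move=> h.
have -> : vsum r S - cut i S = \sum_(v in S) (r v - cut i [set v]) +
   \sum_e ((\sum_(v in S) `|i e v|) - `|vsum (i e) S|).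
  rewrite !sumrB; suff -> : \sum_(v in S) cut i [set v] = \sum_e \sum_(v in S) `|i e v|.
    by rewrite /vsum /cut; ring.
  by rewrite [RHS]exchange_big /=; apply: eq_bigr => v _; rewrite cut1.
apply: rpredD; first exact: dvdz_sum.
apply: dvdz_sum => e _; rewrite /vsum.
elim/big_rec2: _ => // v a b _; lia.
Qed.

Definition mult i u v : int := \sum_e `|i e u| * `|i e v|.

Lemma mult_ge0 i u v : 0 <= mult i u v.
Proof. by apply: sumr_ge0 => e _; rewrite mulr_ge0. Qed.

Lemma deg_mult i W v : (forall e, edgev W (i e)) -> v \in W ->
  cut i [set v] = \sum_(u in W :\ v) mult i v u.
Proof.
move=> h vW; rewrite cut1 /mult exchange_big /=; apply: eq_bigr => e _.
rewrite -mulr_sumr; have [->|nz] := eqVneq (i e v) 0; first by rewrite normr0 mul0r.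
have [u uW [e1 e2]] := other_end (h e) vW nz.
rewrite (bigD1 u) //= big1 => [|w].
  by have := edgev1 (h e) vW; rewrite e1; nia.
by rewrite !inE => /andP[/andP[nwv wW] nwu]; rewrite e2.
Qed.

(** The sum on the right counts the edges that leave [S] and avoid [v]; they lie in both cuts. An
    edge at [v] lies in exactly one of them, the first if its other end is in [S] and the second
    otherwise. *)
Lemma cut_add1 i W S v : (forall e, edgev W (i e)) -> v \in W -> S \subset W -> v \notin S ->
  cut i S + cut i (v |: S) = (\sum_e (1 - `|i e v|) * `|vsum (i e) S|) *+ 2 + cut i [set v].
Proof.
move=> h vW sW vS; rewrite cut1 /cut -sumrMnl -!big_split /=; apply: eq_bigr => e _.
rewrite vsumU1 //.
have [] := edgev_cases (h e) vW sW vS; nia.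
Qed.

Lemma cut_pair i W u v : (forall e, edgev W (i e)) -> u \in W -> v \in W -> u != v ->
  cut i [set u; v] = cut i [set u] + cut i [set v] - mult i u v *+ 2.
Proof.
move=> h uW vW ne; rewrite !cut1 /cut /mult -sumrMnl -big_split -sumrB /=.
apply: eq_bigr => e _; rewrite vsumU1 ?inE // vsum1.
have [] := edgev_two (h e) uW vW ne; nia.
Qed.

Lemma cut_ge0 i S : 0 <= cut i S.
Proof. by apply: sumr_ge0. Qed.

End Graph.

(** * Contraction of a vertex set *)

Section Contraction.
Variables (V E : finType).
Implicit Types (f r : V -> int) (S T W : {set V}) (i : E -> V -> int).

(* Contraction keeps the vertex type: T is represented by x0, and the other vertices
   of T become junk, being outside the new vertex set x0 |: (W :\: T). *)
Definition contract (x0 : V) T f : V -> int := fun v => if v == x0 then vsum f T else f v.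

(** The preimage of [S] under the contraction of [T] to [x0]. *)
Definition expand (x0 : V) T S := if x0 \in S then S :|: T else S.

Lemma vsum_contract x0 T W S f : x0 \in T -> S \subset x0 |: (W :\: T) ->
  vsum (contract x0 T f) S = vsum f (expand x0 T S).
Proof.
move=> xT sS; rewrite /expand.
have nx (S' : {set V}) : x0 \notin S' -> vsum (contract x0 T f) S' = vsum f S'.
  by move=> xS; apply: eq_bigr => v vS; rewrite /contract; case: eqP => // ev; rewrite -ev vS in xS.
have [xS|xS] := boolP (x0 \in S); last exact: nx.
rewrite (vsumD1 _ xS) nx ?setD11 // {1}/contract eqxx -vsumU.
  congr vsum; apply/setP=> v; rewrite !inE.
  by have [->|] := eqVneq v x0; rewrite ?xS ?xT //= orbC.
rewrite -setI_eq0; apply/eqP/setP=> v; rewrite !inE; apply/negP=> /andP[vT /andP[nv vS]].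
by move: (subsetP sS _ vS); rewrite !inE (negPf nv) vT.
Qed.

Lemma expand_sub x0 T W S : T \subset W -> S \subset x0 |: (W :\: T) -> x0 \in T ->
  expand x0 T S \subset W.
Proof.
move=> sT sS xT; rewrite /expand; apply/subsetP=> v.
have h : v \in S -> v \in W.
  by move/(subsetP sS); rewrite !inE => /orP[/eqP->|/andP[]//]; apply: (subsetP sT).
by case: ifP => _ //; rewrite inE => /orP[//|]; apply: (subsetP sT).
Qed.

Lemma cut_contract x0 T W S i : x0 \in T -> S \subset x0 |: (W :\: T) ->
  cut (fun e => contract x0 T (i e)) S = cut i (expand x0 T S).
Proof. by move=> xT sS; apply: eq_bigr => e _; rewrite (vsum_contract _ xT sS). Qed.

Lemma edgev_contract x0 T W (x : V -> int) : x0 \in T -> T \subset W -> edgev W x ->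
  edgev (x0 |: (W :\: T)) (contract x0 T x).
Proof.
move=> xT sT [h1 h2]; split=> [S sS|].
  by rewrite (vsum_contract _ xT sS); apply/h1/expand_sub.
rewrite (vsum_contract _ xT (subxx _)) -[RHS]h2; congr vsum.
rewrite /expand !inE eqxx /=; apply/setP=> v; rewrite !inE.
have [->|_] := eqVneq v x0; first by rewrite (subsetP sT).
by have [vT|] := boolP (v \in T); rewrite ?orbF //= (subsetP sT).
Qed.

Lemma outflow_contract x0 T phi i v :
  outflow phi (fun e => contract x0 T (i e)) v = contract x0 T (outflow phi i) v.
Proof.
rewrite /outflow /contract; case: eqP => // _.
by rewrite /vsum exchange_big /=; apply: eq_bigr => e _; rewrite mulr_sumr.
Qed.

Lemma vsum_outflow phi i S : vsum (outflow phi i) S = \sum_e phi e * vsum (i e) S.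
Proof. by rewrite /vsum exchange_big; apply: eq_bigr => e _; rewrite mulr_sumr. Qed.

End Contraction.

(** * Admissible data, and the reductions by contraction *)

Section Solvability.
Variables (K C0 C1 : int).
Hypotheses (K_gt0 : 0 < K).
Notation M := (2 * K).
Notation g := (dist_mod M).
Variables (V E : finType).
Implicit Types (f r : V -> int) (S T W : {set V}) (i : E -> V -> int) (phi : E -> int).

Definition signs phi := forall e, phi e = 1 \/ phi e = -1.

(* The edges at z come with values prescribed by phi.  The bound on their number and
   the term g (the distance of the demand to M * Z, which orienting an edge the right
   way lowers along with the degree) are what make the induction close. *)
Record admissible i W r z phi : Prop := Admissible {
  adm_edge : forall e, edgev W (i e);
  adm_z : z \in W;
  adm_sum : (M %| vsum r W)%Z;
  adm_parity : forall v, v \in W -> (2 %| r v - cut i [set v])%Z;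
  adm_deg : cut i [set z] <= C0;
  adm_bd : (M %| outflow phi i z - r z)%Z;
  adm_signs : signs phi;
  adm_cut : forall S, S \subset W :\ z -> S != set0 -> S != W :\ z -> C1 + g (vsum r S) <= cut i S }.

(** Keeping [phi0] at [z] is what lets solutions on the two sides of a cut be glued. *)
Definition solves i W r z phi0 phi : Prop :=
  [/\ signs phi, forall e, i e z != 0 -> phi e = phi0 e
    & forall v, v \in W -> (M %| outflow phi i v - r v)%Z].

Definition solvable_below n := forall i W r z phi,
  (#|W| < n)%N -> admissible i W r z phi -> exists phi', solves i W r z phi phi'.

(** Cuts and demand sums of the contraction are those of expanded sets, so only the conditions at
    [z] have to be supplied again. If [z] lies in [T], it must be the representative. *)
Lemma contract_admissible i W r z phi T x0 phi1 :
  admissible i W r z phi -> T \subset W -> x0 \in T -> (z \in T -> z = x0) ->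
  cut i (expand x0 T [set z]) <= C0 ->
  (M %| outflow phi1 (fun e => contract x0 T (i e)) z - contract x0 T r z)%Z -> signs phi1 ->
  admissible (fun e => contract x0 T (i e)) (x0 |: (W :\: T)) (contract x0 T r) z phi1.
Proof.
move=> adm sT xT hz hc hb hs; set W' := x0 |: (W :\: T).
have zW' : z \in W'.
  rewrite !inE (adm_z adm) andbT; have [zT|//] := boolP (z \in T).
    by rewrite (hz zT) eqxx.
  by rewrite orbT.
split=> //.
- by move=> e; apply: edgev_contract (adm_edge adm e).
- rewrite (vsum_contract _ xT (subxx _)).
  suff -> : expand x0 T W' = W by exact: adm_sum adm.
  apply/eqP; rewrite eqEsubset expand_sub //=; apply/subsetP=> v vW.
  by rewrite /expand setU11 !inE vW andbT; case: (v \in T); rewrite ?orbT.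
- move=> v vW'; have sv : [set v] \subset W' by rewrite sub1set.
  rewrite (cut_contract _ xT sv) -vsum1 (vsum_contract _ xT sv).
  apply: cut_parity => u /(subsetP (expand_sub sT sv xT)).
  exact: adm_parity adm u.
- by rewrite (cut_contract (W := W)) // sub1set.
move=> S sS nS0 nS.
have sS' : S \subset W' by apply: subset_trans sS (subD1set _ _).
rewrite (vsum_contract _ xT sS') (cut_contract _ xT sS').
have zS : z \notin S by apply/negP=> /(subsetP sS); rewrite !inE eqxx.
apply: adm_cut adm _ _ _ _.
- apply/subsetP=> v vS; rewrite !inE (subsetP (expand_sub sT sS' xT)) // andbT.
  apply/eqP=> ev; move: vS; rewrite ev /expand; case: ifP => xS; last by rewrite (negPf zS).
  by rewrite inE (negPf zS) /= => /hz zx; rewrite zx xS in zS.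
- case/set0Pn: nS0 => v vS; apply/set0Pn; exists v; rewrite /expand; case: ifP => //.
  by rewrite inE vS.
apply: contra nS => /eqP eS; rewrite eqEsubset sS /=; apply/subsetP=> w.
rewrite !inE => /andP[nwz /orP[/eqP ew|/andP[wT wW]]].
  move: (in_setD1 w W z); rewrite -eS nwz ew (subsetP sT _ xT) /expand.
  by case: ifP => // ->.
have : w \in W :\ z by rewrite !inE nwz.
by rewrite -eS /expand; case: ifP => // _; rewrite inE (negPf wT) orbF.
Qed.

Lemma card_contract x0 T W : T \subset W -> x0 \in T -> #|x0 |: (W :\: T)| = (#|W| - #|T|).+1.
Proof. by move=> sT xT; rewrite cardsU1 !inE xT /= cardsD (setIidPr sT). Qed.

(* Contract T and solve; then contract the complement of T to z, with the values
   just found prescribed on the edges leaving T. *)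
Lemma solve_small_cut i W r z phi T : admissible i W r z phi -> solvable_below #|W| ->
  T \subset W :\ z -> T != W :\ z -> (1 < #|T|)%N -> cut i T <= C0 ->
  exists phi', solves i W r z phi phi'.
Proof.
move=> adm IH sTz nT cT dT.
have zW := adm_z adm.
have sT : T \subset W := subset_trans sTz (subD1set _ _).
have zT : z \notin T by apply/negP=> /(subsetP sTz); rewrite !inE eqxx.
have /set0Pn[x0 xT] : T != set0 by rewrite -card_gt0; apply: ltn_trans cT.
have nxz : (z == x0) = false by apply: contraNF zT => /eqP->.
have cTW := subset_leq_card sT.
have adm1 : admissible (fun e => contract x0 T (i e)) (x0 |: (W :\: T)) (contract x0 T r) z phi.
  apply: (contract_admissible adm) => //.
  - by move=> zT'; rewrite zT' in zT.
  - by rewrite /expand inE eq_sym nxz; exact: adm_deg adm.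
  - by rewrite outflow_contract /contract nxz; exact: adm_bd adm.
  - exact: adm_signs adm.
have [|phi1 [s1 a1 f1]] := IH _ _ _ _ _ _ adm1; first by rewrite card_contract //; move: cT cTW; clear; lia.
have f1' v : v \in W -> v \notin T -> (M %| outflow phi1 i v - r v)%Z.
  move=> vW vT; have nv : (v == x0) = false by apply: contraNF vT => /eqP->.
  by move: (f1 v); rewrite outflow_contract /contract !inE nv vW vT => /(_ isT).
have f1T : (M %| vsum (outflow phi1 i) T - vsum r T)%Z.
  by move: (f1 x0); rewrite outflow_contract /contract !inE eqxx => /(_ isT).
have sU : W :\: T \subset W := subsetDl _ _.
have eW : W :\: (W :\: T) = T by rewrite setDDr setDv set0U (setIidPr sT).
have zU : z \in W :\: T by rewrite !inE zT.
(* All demands in [W :\: T] are met by [phi1], so the merged demand at [z] is met as well: this is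
   the boundary condition of the second contraction. *)
have bdU : (M %| vsum (outflow phi1 i) (W :\: T) - vsum r (W :\: T))%Z.
  by rewrite /vsum -sumrB; apply: dvdz_sum => v; rewrite inE => /andP[vT vW]; exact: f1'.
have adm2 : admissible (fun e => contract z (W :\: T) (i e)) (z |: (W :\: (W :\: T)))
              (contract z (W :\: T) r) z phi1.
  apply: (contract_admissible adm) => //.
    rewrite /expand inE eqxx (setUidPr _) ?sub1set //.
    by rewrite (cut_compl (adm_edge adm)).
  by rewrite outflow_contract /contract eqxx.
have [|phi2 [s2 a2 f2]] := IH _ _ _ _ _ _ adm2.
  rewrite card_contract //.
  have : (#|T| < #|W :\ z|)%N by apply: proper_card; rewrite properEneq nT.
  have := cardsD1 z W; have := cardsDS sT; move: cT; rewrite zW; clear; lia.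
have f2' v : v \in T -> (M %| outflow phi2 i v - r v)%Z.
  move=> vT; have nv : (v == z) = false by apply: contraNF zT => /eqP<-.
  by move: (f2 v); rewrite outflow_contract /contract eW !inE nv vT => /(_ isT).
(* Edges meeting [T] take [phi2], the others [phi1]. An edge of the cut ends at the merged [z] of
   the second contraction, where [phi1] was prescribed, so both sides see the same value. *)
pose inT e := [exists v in T, i e v != 0].
have agree e v : v \in W -> v \notin T -> inT e -> i e v != 0 -> phi2 e = phi1 e.
  move=> vW vT /exists_inP[u uT nu] nv; apply: a2; rewrite /contract eqxx.
  have uW := subsetP sT _ uT.
  have [w wW [e1 e2]] := other_end (adm_edge adm e) vW nv.
  have ewu : u = w.
    apply/eqP/negPn/negP=> nuw; move: nu; rewrite e2 ?eqxx //.
    by apply: contraNN vT => /eqP<-.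
  have hs := proj2 (adm_edge adm e).
  move: hs; rewrite (vsumD _ sT) => hs.
  have : vsum (i e) T = i e u.
    rewrite (vsumD1 _ uT) /vsum big1 ?addr0 // => y; rewrite !inE => /andP[ny yT].
    rewrite e2 -?ewu ?(subsetP sT) //; apply: contraNN vT => /eqP<-//.
  by move=> eT; apply: contraNneq nu => e0; move: hs; rewrite e0 addr0 eT => ->.
exists (fun e => if inT e then phi2 e else phi1 e); split.
- by move=> e; case: ifP.
- move=> e nz; case: ifP => he; first rewrite (agree _ z) //.
    by apply: a1; rewrite /contract nxz.
  by apply: a1; rewrite /contract nxz.
move=> v vW; have [vT|vT] := boolP (v \in T).
  suff -> : outflow (fun e => if inT e then phi2 e else phi1 e) i v = outflow phi2 i v by exact: f2'.
  apply: eq_bigr => e _; case: ifP => // /negbT; rewrite negb_exists_in => /forall_inP/(_ v vT).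
  by rewrite negbK => /eqP->; rewrite !mulr0.
suff -> : outflow (fun e => if inT e then phi2 e else phi1 e) i v = outflow phi1 i v by exact: f1'.
apply: eq_bigr => e _; case: ifP => // he.
by have [->|nz] := eqVneq (i e v) 0; [rewrite !mulr0 | rewrite (agree _ v)].
Qed.

Lemma sum_signs (A : {set E}) (t : int) : `|t| <= #|A|%:Z -> (2 %| t - #|A|%:Z)%Z ->
  exists2 psi, signs psi & \sum_(e in A) psi e = t.
Proof.
move=> ht pt; have [q eq] := dvdzP pt.
have q0 : q <= 0 by lia.
have : (`|q| <= #|A|)%N by lia.
move=> hq.
have [B sB cB] := exists_subset_card hq.
exists (fun e => if e \in B then -1 else 1); first by move=> e; case: ifP; [right | left].
rewrite (big_setID B) /= (setIidPr sB).
rewrite (eq_bigr (fun=> -1)) => [|e ->//].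
rewrite [X in _ + X](eq_bigr (fun=> 1)) => [|e]; last by rewrite inE => /andP[/negPf->].
rewrite !sumr_const cardsDS // cB; lia.
Qed.

(* Contract x and y and solve; the K parallel edges realise every residue of the
   right parity, which repairs the demand at x. *)
Lemma solve_parallel i W r z phi x y : admissible i W r z phi -> solvable_below #|W| ->
  x \in W :\ z -> y \in W :\ z -> x != y -> K <= mult i x y ->
  exists phi', solves i W r z phi phi'.
Proof.
move=> adm IH; rewrite !inE => /andP[nxz xW] /andP[nyz yW] nxy hm.
pose T := [set x; y].
have xT : x \in T by rewrite !inE eqxx.
have yT : y \in T by rewrite !inE eqxx orbT.
have sT : T \subset W by apply/subsetP=> w; rewrite !inE => /orP[]/eqP->.
have zT : z \notin T by rewrite !inE negb_or ![z == _]eq_sym nxz.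
have cT : #|T| = 2 by rewrite cards2 nxy.
have cTW := subset_leq_card sT.
have zx : (z == x) = false by rewrite eq_sym; apply/negbTE.
have adm1 : admissible (fun e => contract x T (i e)) (x |: (W :\: T)) (contract x T r) z phi.
  apply: (contract_admissible adm) => //.
  - by move=> zT'; rewrite zT' in zT.
  - by rewrite /expand inE eq_sym zx; exact: adm_deg adm.
  - by rewrite outflow_contract /contract zx; exact: adm_bd adm.
  - exact: adm_signs adm.
have [|phi1 [s1 a1 f1]] := IH _ _ _ _ _ _ adm1; first by rewrite card_contract //; move: cT cTW; clear; lia.
have f1' v : v \in W -> v \notin T -> (M %| outflow phi1 i v - r v)%Z.
  move=> vW vT; have nv : (v == x) = false by apply: contraNF vT => /eqP->.
  by move: (f1 v); rewrite outflow_contract /contract nv in_setU1 in_setD vT vW orbT => /(_ isT).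
have f1T : (M %| vsum (outflow phi1 i) T - vsum r T)%Z.
  by move: (f1 x); rewrite outflow_contract /contract eqxx setU11 => /(_ isT).
pose P := [set e | (i e x != 0) && (i e y != 0)].
have onP e : e \in P -> [/\ i e y = - i e x, (i e x = 1 \/ i e x = -1) &
    forall v, v \in W -> v \notin T -> i e v = 0].
  rewrite inE => /andP[nx ny].
  have [u uW [e1 e2]] := other_end (adm_edge adm e) xW nx.
  have eu : y = u by apply/eqP/negPn/negP=> nyu; move: ny; rewrite e2 ?eqxx // eq_sym.
  rewrite eu; split=> //; first exact: edgev_unit (adm_edge adm e) xW nx.
  by move=> v vW; rewrite !inE negb_or => /andP[nv nv']; rewrite e2 // -eu.
have cP : mult i x y = #|P|%:Z.
  rewrite /mult (bigID (mem P)) /= [X in _ + X]big1 => [|e]; last first.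
    by rewrite inE negb_and !negbK => /orP[]/eqP->; rewrite normr0 ?mul0r ?mulr0.
  rewrite addr0 (eq_bigr (fun=> 1)) ?sumr_const ?natz // => e /onP[-> h _].
  by case: h => ->.
(* [c] is what [x] sends through edges that do not go to [y]. Modulo 2K the missing amount has a
   representative of size at most [K], within reach of the edges in [P]; its parity is that of their
   number. *)
pose c := \sum_(e | e \notin P) phi1 e * i e x.
have pc : (2 %| r x - c - #|P|%:Z)%Z.
  have h1 : (2 %| r x - (#|P|%:Z + \sum_(e | e \notin P) `|i e x|))%Z.
    have := adm_parity adm xW; rewrite cut1 (bigID (mem P)) /=.
    rewrite (eq_bigr (fun=> 1)) => [|e /onP[_ h _]]; last by case: h => ->.
    rewrite sumr_const => h. rewrite -[#|P|%:Z]natz. exact: h.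
  have h2 : (2 %| (\sum_(e | e \notin P) `|i e x|) - c)%Z.
    rewrite /c -sumrB; apply: dvdz_sum => e _.
    exact: sign_parity (edgev1 (adm_edge adm e) xW) (s1 e).
  move: h1 h2; move: (\sum_(e | _) `|_|) => a; clearbody c; clear; lia.
have [g0 gK [s [q [hs eg]]]] := dist_modP (r x - c) K_gt0.
have [||psi spsi epsi] := @sum_signs P (s * g (r x - c)).
- by rewrite -cP; move: hm g0 gK; case: hs => ->; clear; lia.
- have -> : s * g (r x - c) - #|P|%:Z = r x - c - #|P|%:Z - 2 * (q * K) by rewrite {2}eg; ring.
  by apply: rpredB => //; rewrite dvdz_mulr.
(* [psi e] is measured as flow out of [x]. The change stays inside [T], so once [x] is right, [y]
   follows from the total over [T]. *)
pose phi' e := if e \in P then psi e * i e x else phi1 e.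
have f_x : outflow phi' i x = s * g (r x - c) + c.
  rewrite /outflow (bigID (mem P)) /= -epsi; congr (_ + _).
    apply: eq_bigr => e eP; rewrite /phi' eP; have [_ h _] := onP _ eP.
    by case: h => ->; ring.
  by apply: eq_bigr => e eP; rewrite /phi' (negPf eP).
have fxy (psi' : E -> int) : vsum (outflow psi' i) T = outflow psi' i x + outflow psi' i y.
  by rewrite vsumU1 ?inE // vsum1.
have f_T : vsum (outflow phi' i) T = vsum (outflow phi1 i) T.
  rewrite !vsum_outflow; apply: eq_bigr => e _; rewrite /phi'; case: ifP => // /onP[ey _ _].
  by rewrite vsumU1 ?inE // vsum1 ey subrr !mulr0.
have dx : (M %| outflow phi' i x - r x)%Z.
  have -> : outflow phi' i x - r x = - q * M.
    by rewrite f_x; move: eg; move: (dist_mod _ _) => d; clearbody c; clear; lia.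
  by rewrite dvdz_mull.
exists phi'; split.
- move=> e; rewrite /phi'; case: ifP => // /onP[_ h _].
  by move: h (spsi e); clear; lia.
- move=> e nz; rewrite /phi'; case: ifP => [/onP[_ _ h]|_].
    by rewrite (h z (adm_z adm) zT) eqxx in nz.
  by apply: a1; rewrite /contract zx.
move=> v vW; have [vT|vT] := boolP (v \in T); last first.
  suff -> : outflow phi' i v = outflow phi1 i v by exact: f1'.
  apply: eq_bigr => e _; rewrite /phi'; case: ifP => // /onP[_ _ h].
  by rewrite (h v vW vT) !mulr0.
move: vT; rewrite !inE => /orP[]/eqP-> //.
have eT : vsum r T = r x + r y by rewrite vsumU1 ?inE // vsum1.
have -> : outflow phi' i y - r y =
  (vsum (outflow phi1 i) T - vsum r T) - (outflow phi' i x - r x).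
  by rewrite -f_T fxy eT; ring.
exact: rpredB.
Qed.

End Solvability.

(** * Splitting off pairs of edges and erasing oriented edges *)

Section Lifting.
Variable K : int.
Variables (V E : finType).
Implicit Types (f r : V -> int) (S T W : {set V}) (i : E -> V -> int) (phi : E -> int).

Lemma sum_update2 (F F' : E -> int) e1 e2 : e1 != e2 ->
  (forall e, e != e1 -> e != e2 -> F' e = F e) ->
  \sum_e F' e = \sum_e F e + (F' e1 - F e1) + (F' e2 - F e2).
Proof.
move=> ne h; have ne' : e2 != e1 by rewrite eq_sym.
rewrite (bigD1 e1) // (bigD1 e2) //= [\sum_e F e](bigD1 e1) // [in RHS](bigD1 e2) //=.
rewrite (eq_bigr F) => [|e /andP[]]; last exact: h.
by clear; ring.
Qed.

(* The path through x formed by e1 and e2 becomes the single edge e1; e2 is deleted. *)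
Definition split_off i e1 e2 x : E -> V -> int := fun e =>
  if e == e2 then fun=> 0 else
  if e == e1 then fun v => i e1 v - i e1 x * i e2 x * i e2 v else i e.

(** The roles are not symmetric: [e1] survives and may end at [z], while [e2] is deleted and must
    avoid [z], where values are prescribed. By [lift_ends] the far ends differ, so no loop arises
    and all degrees except that of [x] are kept. *)
Record liftable i W z x e1 e2 : Prop := Liftable {
  lift_edge : forall e, edgev W (i e);
  lift_x : x \in W;
  lift_z : z \in W;
  lift_xz : x != z;
  lift_neq : e1 != e2;
  lift_1x : i e1 x = 1 \/ i e1 x = -1;
  lift_2x : i e2 x = 1 \/ i e2 x = -1;
  lift_2z : i e2 z = 0;
  lift_ends : forall u, u \in W -> u != x -> i e1 u = 0 \/ i e2 u = 0 }.

Section OneLift.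
Variables (i : E -> V -> int) (W : {set V}) (z x : V) (e1 e2 : E).
Hypothesis L : liftable i W z x e1 e2.
Notation j := (split_off i e1 e2 x).

Let je2 : j e2 = fun=> 0.
Proof. by rewrite /split_off eqxx. Qed.

Let je1 : j e1 = fun v => i e1 v - i e1 x * i e2 x * i e2 v.
Proof. by rewrite /split_off (negPf (lift_neq L)) eqxx. Qed.

Let jo e : e != e1 -> e != e2 -> j e = i e.
Proof. by move=> /negPf n1 /negPf n2; rewrite /split_off n1 n2. Qed.

Let v1 S : vsum (j e1) S = vsum (i e1) S - i e1 x * i e2 x * vsum (i e2) S.
Proof. by rewrite je1 /vsum sumrB mulr_sumr. Qed.

Let v2 S : vsum (j e2) S = 0.
Proof. by rewrite je2 /vsum big1. Qed.

Lemma lift_at_x e : j e x = 0 \/ e != e1 /\ e != e2 /\ j e x = i e x.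
Proof.
have [->|n2] := eqVneq e e2; first by left; rewrite je2.
have [->|n1] := eqVneq e e1; last by right; rewrite jo.
left; rewrite je1; case: (lift_1x L) => ->; case: (lift_2x L) => ->; ring.
Qed.

Lemma edgev_lift e : edgev W (j e).
Proof.
have [->|n2] := eqVneq e e2; first by rewrite je2; apply: edgev0.
have [->|n1] := eqVneq e e1; last by rewrite jo //; apply: lift_edge L e.
split=> [S sS|]; last first.
  by rewrite v1 (proj2 (lift_edge L e1)) (proj2 (lift_edge L e2)); ring.
wlog xS : S sS / x \notin S.
  move=> hw; have [xS|xS] := boolP (x \in S); last exact: hw.
  rewrite (vsumD1 _ xS); have -> : j e1 x = 0 by case: (lift_at_x e1) => // -[/eqP].
  rewrite add0r; apply: hw; rewrite ?setD11 //; exact: subset_trans (subD1set _ _) sS.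
rewrite v1; have [] := edgev_cases (lift_edge L e1) (lift_x L) sS xS.
have [] := edgev_cases (lift_edge L e2) (lift_x L) sS xS.
case: (lift_1x L) => ->; case: (lift_2x L) => ->; lia.
Qed.

Lemma cut_lift_diff S : cut j S = cut i S - `|vsum (i e1) S| - `|vsum (i e2) S| + `|vsum (j e1) S|.
Proof.
rewrite /cut (sum_update2 (F := fun e => `|vsum (i e) S|) (lift_neq L)).
  by rewrite v2 normr0; ring.
by move=> e n1 n2; rewrite jo.
Qed.

Lemma cut_lift_ge S : S \subset W -> cut i S - 2 <= cut j S.
Proof.
move=> sS; rewrite cut_lift_diff.
have := proj1 (lift_edge L e1) S sS; have := proj1 (lift_edge L e2) S sS; lia.
Qed.

Lemma cut_lift_other u : u \in W -> u != x -> cut j [set u] = cut i [set u].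
Proof.
move=> uW nu; rewrite cut_lift_diff v1 !vsum1.
case: (lift_ends L uW nu) => ->; case: (lift_1x L) => ->; case: (lift_2x L) => ->; lia.
Qed.

Lemma cut_lift_x : cut j [set x] = cut i [set x] - 2.
Proof.
rewrite cut_lift_diff v1 !vsum1.
case: (lift_1x L) => ->; case: (lift_2x L) => ->; lia.
Qed.

Lemma lift_at_z e : j e z = i e z.
Proof.
have [->|n2] := eqVneq e e2; first by rewrite je2 (lift_2z L).
have [->|n1] := eqVneq e e1; last by rewrite jo.
by rewrite je1 (lift_2z L) mulr0 subr0.
Qed.

(** Both split edges end at [x], so neither counts on the left; the new edge avoids [x] and can only
    add on the right. *)
Lemma avoid_lift S : S \subset W -> x \notin S ->
  \sum_e (1 - `|i e x|) * `|vsum (i e) S| <= \sum_e (1 - `|j e x|) * `|vsum (j e) S|.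
Proof.
move=> sS xS.
rewrite [leRHS](sum_update2 (F := fun e => (1 - `|i e x|) * `|vsum (i e) S|) (lift_neq L)); last first.
  by move=> e n1 n2; rewrite jo.
have -> : j e1 x = 0 by case: (lift_at_x e1) => // -[/eqP].
rewrite v2.
suff n1 a : a = 1 \/ a = -1 -> `|a| = 1 :> int.
  rewrite (n1 _ (lift_1x L)) (n1 _ (lift_2x L)) normr0.
  by rewrite subrr subr0 !mul0r mulr0 mul1r subrr addr0 lerDl normr_ge0.
by case=> ->.
Qed.

Lemma mult_lift u : mult j x u = mult i x u - `|i e1 u| - `|i e2 u|.
Proof.
rewrite /mult (sum_update2 (F := fun e => `|i e x| * `|i e u|) (lift_neq L)); last first.
  by move=> e n1 n2; rewrite jo.
have -> : j e1 x = 0 by case: (lift_at_x e1) => // -[/eqP].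
rewrite je2.
by case: (lift_1x L) => ->; case: (lift_2x L) => ->; rewrite ?normrN1 ?normr1 normr0; ring.
Qed.

(** The deleted edge receives the value that lets the flow of the new edge pass through [x]; the
    product of signs translates between the reference directions of [e1] and [e2]. *)
Lemma solves_lift r phi0 phi : solves K j W r z phi0 phi -> exists phi', solves K i W r z phi0 phi'.
Proof.
case=> s a h; exists (fun e => if e == e2 then - (i e1 x * i e2 x) * phi e1 else phi e); split.
- move=> e; case: eqP => // _.
  case: (lift_1x L) => ->; case: (lift_2x L) => ->; case: (s e1) => ->; lia.
- move=> e nz; have -> : (e == e2) = false by apply: contraNF nz => /eqP->; rewrite (lift_2z L).
  by apply: a; rewrite lift_at_z.
move=> v vW; move: (h v vW).
suff -> : outflow (fun e => if e == e2 then - (i e1 x * i e2 x) * phi e1 else phi e) i v = outflow phi j v by [].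
rewrite /outflow (sum_update2 (F := fun e => phi e * j e v) (lift_neq L)); last first.
  by move=> e n1 n2; rewrite jo // (negPf n2).
by rewrite je1 je2 eqxx (negPf (lift_neq L)); ring.
Qed.

Lemma support_lift : [set e | [exists v, j e v != 0]] \proper [set e | [exists v, i e v != 0]].
Proof.
have nz a : a = 1 \/ a = -1 -> a != 0 :> int by case=> ->.
apply/properP; split; last first.
  exists e2; rewrite inE; last by apply/existsPn=> v; rewrite je2 eqxx.
  by apply/existsP; exists x; apply: nz; exact: lift_2x L.
apply/subsetP=> e; rewrite !inE => /existsP[v].
have [->|n2] := eqVneq e e2; first by rewrite je2 eqxx.
have [->|n1] := eqVneq e e1; last by rewrite jo // => h; apply/existsP; exists v.
by move=> _; apply/existsP; exists x; apply: nz; exact: lift_1x L.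
Qed.

End OneLift.

Lemma mult_pos i x u : 0 < mult i x u -> exists e, i e x != 0 /\ i e u != 0.
Proof.
case: (pickP (fun e => (i e x != 0) && (i e u != 0))) => [e /andP[n1 n2] _|h]; first by exists e.
rewrite /mult big1 // => e _; move: (h e) => /negbT; rewrite negb_and !negbK => /orP[]/eqP->.
  by rewrite normr0 mul0r.
by rewrite normr0 mulr0.
Qed.

Lemma liftable_ends i W z x a b e1 e2 : (forall e, edgev W (i e)) -> x \in W -> z \in W -> x != z ->
  a \in W :\ x -> b \in W :\ x -> a != b -> b != z ->
  i e1 x != 0 -> i e1 a != 0 -> i e2 x != 0 -> i e2 b != 0 -> liftable i W z x e1 e2.
Proof.
move=> h xW zW xz; rewrite !inE => /andP[nax aW] /andP[nbx bW] nab nbz n1x n1a n2x n2b.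
have [u uW [_ h1]] := other_end (h e1) xW n1x.
have [w wW [_ h2]] := other_end (h e2) xW n2x.
have eu : a = u by apply/eqP/negPn/negP=> n; rewrite h1 ?eqxx in n1a.
have ew : b = w by apply/eqP/negPn/negP=> n; rewrite h2 ?eqxx in n2b.
subst u w; split=> //.
- by apply: contraNneq n2b => <-; rewrite h1 // eq_sym.
- exact: edgev_unit (h _) xW n1x.
- exact: edgev_unit (h _) xW n2x.
- by apply: h2 => //; rewrite eq_sym.
move=> u uW' nu; have [eua|nua] := eqVneq u a; last by left; apply: h1.
by right; apply: h2 => //; rewrite eua.
Qed.

(* All edges at x are split off in pairs; pairing a neighbour of largest multiplicity
   each time preserves the bound by half the degree. *)
Lemma lift_all i W z x : (forall e, edgev W (i e)) -> x \in W -> z \in W -> x != z ->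
  (2 %| cut i [set x])%Z -> (forall u, u \in W :\ x -> 2 * mult i x u <= cut i [set x]) ->
  exists j, [/\ forall e, edgev W (j e), forall e, j e x = 0,
    forall u, u \in W -> u != x -> cut j [set u] = cut i [set u],
    forall S, S \subset W -> x \notin S -> \sum_e (1 - `|i e x|) * `|vsum (i e) S| <= cut j S &
    (forall e, j e z = i e z) /\
    forall r phi0 phi, solves K j W r z phi0 phi -> exists phi', solves K i W r z phi0 phi'].
Proof.
move=> + xW zW xz; have [n] := ubnP `|cut i [set x]|%N.
elim: n i => // n IH i hn h par hm.
have [c0|cn0] := eqVneq (cut i [set x]) 0.
  have hx e : i e x = 0.
    move: c0; rewrite cut1 => /eqP; rewrite psumr_eq0 // => /allP/(_ e).
    by rewrite mem_index_enum => /(_ isT)/=; rewrite normr_eq0 => /eqP.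
  exists i; split=> //; last by split=> // r phi0 phi; exists phi.
  move=> S sS xS; rewrite le_eqVlt; apply/orP; left; apply/eqP.
  by apply: eq_bigr => e _; rewrite hx normr0 subr0 mul1r.
have cpos : 0 < cut i [set x] by rewrite lt_def cn0 cut_ge0.
(* After one splitting the degree of [x] is smaller by two, and so must be the bound on twice each
   multiplicity. At [a] and [b] a multiplicity drops; elsewhere the slack of one becomes two because
   the degree is even. *)
have key a b e1 e2 : a \in W :\ x -> b \in W :\ x -> a != b -> b != z ->
  i e1 x != 0 -> i e1 a != 0 -> i e2 x != 0 -> i e2 b != 0 ->
  (forall v, v \in W :\ x -> v != a -> v != b -> 2 * mult i x v <= cut i [set x] - 1) ->
  exists j, [/\ forall e, edgev W (j e), forall e, j e x = 0,
    forall u, u \in W -> u != x -> cut j [set u] = cut i [set u],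
    forall S, S \subset W -> x \notin S -> \sum_e (1 - `|i e x|) * `|vsum (i e) S| <= cut j S &
    (forall e, j e z = i e z) /\
    forall r phi0 phi, solves K j W r z phi0 phi -> exists phi', solves K i W r z phi0 phi'].
  move=> aW bW nab nbz n1x n1a n2x n2b hv.
  have L := liftable_ends h xW zW xz aW bW nab nbz n1x n1a n2x n2b.
  have cx := cut_lift_x L.
  have [||||j [j1 j2 j3 j4 [j5 j6]]] := IH (split_off i e1 e2 x).
  - by have := cut_ge0 (split_off i e1 e2 x) [set x]; rewrite cx; move: hn; clear; lia.
  - exact: edgev_lift L.
  - rewrite cx; exact: rpredB.
  - move=> u uW; rewrite cx (mult_lift L).
    have [eu|nua] := eqVneq u a.
      have := hm _ uW; have := normr_ge0 (i e2 u); move: n1a; rewrite -eu; clear; lia.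
    have [eu|nub] := eqVneq u b.
      have := hm _ uW; have := normr_ge0 (i e1 u); move: n2b; rewrite -eu; clear; lia.
    by move: (hv _ uW nua nub) par (normr_ge0 (i e1 u)) (normr_ge0 (i e2 u)); clear; lia.
  exists j; split=> //.
  - by move=> u uW nu; rewrite j3 // (cut_lift_other L).
  - move=> S sS xS; apply: le_trans (j4 S sS xS); exact: avoid_lift L S sS xS.
  split=> [e|r phi0 phi /j6[phi1 s1]]; first by rewrite j5 (lift_at_z L).
  exact: solves_lift L _ _ _ s1.
have dm := deg_mult h xW.
have [u0 u0W] : exists u0, u0 \in W :\ x.
  by apply/set0Pn; apply: contraTneq cpos => e0; rewrite dm e0 big_set0.
case: (@arg_maxnP _ u0 (mem (W :\ x)) (fun u => `|mult i x u|%N) u0W) => u uW umax.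
have umax' v : v \in W :\ x -> mult i x v <= mult i x u.
  by move=> vW; move: (umax v vW) (mult_ge0 i x v) (mult_ge0 i x u); clear; lia.
have upos : 0 < mult i x u.
  rewrite ltNge; apply/negP=> le0; move: cpos; rewrite dm big1 // => v vW.
  by move: (umax' v vW) (mult_ge0 i x v) le0; clear; lia.
have [w /andP[wW nwu] wpos] : exists2 w, (w \in W :\ x) && (w != u) & 0 < mult i x w.
  case: (pickP (fun w => ((w \in W :\ x) && (w != u)) && (0 < mult i x w))) => [w /andP[]|no].
    by exists w.
  have := hm u uW; rewrite dm (bigD1 u) //= big1 => [|v hv]; first by move: upos; clear; lia.
  by move: (no v) (mult_ge0 i x v); rewrite hv /=; clear; lia.
(* Three neighbours [u], [w], [v] share the degree, with [v] not above [u] and [w] contributing at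
   least one edge. *)
have hv v : v \in W :\ x -> v != u -> v != w -> 2 * mult i x v <= cut i [set x] - 1.
  move=> vW nvu nvw; have := umax' v vW.
  have : mult i x u + mult i x w + mult i x v <= cut i [set x].
    rewrite dm (bigD1 u) // (bigD1 w) /= ?wW // (bigD1 v) /=; last by rewrite vW nvu.
    rewrite !addrA lerDl; apply: sumr_ge0 => y _; exact: mult_ge0.
  by move: wpos; clear; lia.
have [eu [eux euu]] := mult_pos upos.
have [ew [ewx eww]] := mult_pos wpos.
(* [z] can only be the far end of the surviving edge, so the pair is ordered accordingly. *)
have [ewz|nwz] := eqVneq w z.
  apply: (key w u ew eu) => //; first by rewrite -ewz eq_sym.
  by move=> v vW n1 n2; apply: hv.
by apply: (key u w eu ew) => //; rewrite eq_sym.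
Qed.

Definition erase i (Q : {set E}) : E -> V -> int := fun e => if e \in Q then fun=> 0 else i e.

Lemma sum_erase i (Q : {set E}) (F : E -> (V -> int) -> int) : (forall e, F e (fun=> 0) = 0) ->
  \sum_e F e (erase i Q e) = \sum_e F e (i e) - \sum_(e in Q) F e (i e).
Proof.
move=> F0; rewrite [\sum_e F e (i e)](bigID (mem Q)) /= addrC addrK (bigID (mem Q)) /=.
rewrite big1 => [|e eQ]; last by rewrite /erase eQ.
by rewrite add0r; apply: eq_bigr => e eQ; rewrite /erase (negPf eQ).
Qed.

Lemma vsum0 S : vsum (fun=> 0) S = 0.
Proof. by rewrite /vsum big1. Qed.

Lemma cut_erase i Q S : cut (erase i Q) S = cut i S - \sum_(e in Q) `|vsum (i e) S|.
Proof. by rewrite /cut (sum_erase i Q (F := fun e f => `|vsum f S|)) // => e; rewrite vsum0. Qed.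

Lemma edgev_erase i Q W : (forall e, edgev W (i e)) -> forall e, edgev W (erase i Q e).
Proof. by move=> h e; rewrite /erase; case: ifP => // _; apply: edgev0. Qed.

Lemma solves_erase i (Q : {set E}) W r z tau phi0 phi : signs tau -> (forall e, e \in Q -> i e z = 0) ->
  solves K (erase i Q) W (fun v => r v - \sum_(e in Q) tau e * i e v) z phi0 phi ->
  exists phi', solves K i W r z phi0 phi'.
Proof.
move=> st hQ [s a h]; exists (fun e => if e \in Q then tau e else phi e); split.
- by move=> e; case: ifP.
- move=> e nz; have eQ : (e \in Q) = false by apply: contraNF nz => /hQ->.
  by rewrite eQ; apply: a; rewrite /erase eQ.
move=> v vW; have := h v vW.
have -> : outflow (fun e => if e \in Q then tau e else phi e) i v =
    \sum_(e in Q) tau e * i e v + \sum_(e | e \notin Q) phi e * i e v.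
  rewrite /outflow (bigID (mem Q)) /=.
  by congr (_ + _); apply: eq_bigr => e; [move=> -> | move/negPf=> ->].
have -> : outflow phi (erase i Q) v = \sum_(e | e \notin Q) phi e * i e v.
  rewrite /outflow (bigID (mem Q)) /= big1 ?add0r => [|e eQ]; last by rewrite /erase eQ mulr0.
  by apply: eq_bigr => e /negPf eQ; rewrite /erase eQ.
by congr (is_true (_ %| _)%Z); ring.
Qed.

Lemma erase_parity i (Q : {set E}) W r tau v : (forall e, edgev W (i e)) -> v \in W -> signs tau ->
  (2 %| r v - cut i [set v])%Z ->
  (2 %| r v - \sum_(e in Q) tau e * i e v - cut (erase i Q) [set v])%Z.
Proof.
move=> h vW st hp; rewrite cut_erase; set a := \sum_(e in Q) _; set c := \sum_(e in Q) _.
have hac : (2 %| c - a)%Z.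
  rewrite /a /c -sumrB; apply: dvdz_sum => e _; rewrite vsum1.
  exact: sign_parity (edgev1 (h e) vW) (st e).
by move: hp hac; clear; clearbody a c; clear; lia.
Qed.

Lemma vsum_erase i (Q : {set E}) W r (tau : E -> int) : (forall e, edgev W (i e)) ->
  vsum (fun v => r v - \sum_(e in Q) tau e * i e v) W = vsum r W.
Proof.
move=> h; rewrite /vsum sumrB exchange_big /= [X in _ - X]big1 ?subr0 // => e _.
by rewrite -mulr_sumr; have := proj2 (h e); rewrite /vsum => ->; rewrite mulr0.
Qed.

End Lifting.

(** * Reductions that delete a vertex or an edge *)

Section Reductions.
Variables (K C0 C1 : int).
Hypotheses (K_gt0 : 0 < K) (C0E : C0 = 2 * C1 - 2 * K) (C1_even : (2 %| C1)%Z).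
Hypothesis C1_K : 16 * K <= C1.
Notation M := (2 * K).
Notation g := (dist_mod M).
Variables (V E : finType).
Implicit Types (f r : V -> int) (S T W : {set V}) (i : E -> V -> int) (phi : E -> int).
Notation admissible := (admissible K C0 C1).
Notation solves := (solves K).
Notation solvable_below := (@solvable_below K C0 C1 V E).

Lemma multC i u v : mult i u v = mult i v u.
Proof. by apply: eq_bigr => e _; rewrite mulrC. Qed.

(** Since [r] is congruent to [s * g r], a unit step by [s] approaches a multiple of the modulus.
    This drop of the distance pays for the unit of degree lost with an oriented edge. *)
Lemma distD (s r t : int) : s = 1 \/ s = -1 -> (M %| r - s * g r)%Z -> 0 < g r ->
  t = r - s -> g t <= g r - 1.
Proof.
move=> hs /dvdzP[q hq] g0 ->.
have M0 : 0 < M by move: K_gt0; clear; lia.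
have e : r - s = s * (g r - 1) + q * M by move: hq; move: (g r) => d; clear; lia.
by apply: le_trans (dist_mod_le M0 e) _; move: hs g0; clear; lia.
Qed.

Lemma dist_range (r : int) : 0 <= g r <= K.
Proof. by have [-> -> _] := dist_modP r K_gt0. Qed.

Lemma dist_parity (r : int) : (2 %| r - g r)%Z.
Proof.
have [_ _ [s [q [hs e]]]] := dist_modP r K_gt0.
have -> : r - g r = (s - 1) * g r + 2 * (q * K) by rewrite {1}e; ring.
apply: rpredD; last by rewrite dvdz_mulr.
by apply: dvdz_mulr; case: hs => ->.
Qed.

Lemma dist_type (r : int) : (M %| r - g r)%Z \/ (M %| r + g r)%Z.
Proof.
have [_ _ [s [q [[->|->] e]]]] := dist_modP r K_gt0; [left|right].
  by apply/dvdzP; exists q; rewrite {1}e; ring.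
by apply/dvdzP; exists q; rewrite {1}e; ring.
Qed.

Lemma edgev_del W x (y : V -> int) : x \in W -> y x = 0 -> edgev W y -> edgev (W :\ x) y.
Proof.
move=> xW yx [h1 h2]; split=> [S sS|]; first by apply: h1; apply: subset_trans sS (subD1set _ _).
by move: h2; rewrite (vsumD1 _ xW) yx add0r.
Qed.

(* The edges of Q are oriented by tau and the others at x split off.  For a set S
   avoiding x, the edges between S and the rest minus x number at least
   (cut S + cut (x |: S) - deg x) / 2, so no cut becomes small. *)
Lemma delete_vertex i W r z phi x (Q : {set E}) tau : admissible i W r z phi ->
  solvable_below #|W| -> x \in W -> x != z -> signs tau ->
  let i1 := erase i Q in
  let r1 := fun v => r v - \sum_(e in Q) tau e * i e v in
  (forall e, e \in Q -> i e x != 0 /\ i e z = 0) ->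
  (forall y, y \in W -> y != z -> y != x -> C1 + g (r1 y) <= cut i1 [set y]) ->
  (2 %| cut i1 [set x])%Z ->
  (forall u, u \in W :\ x -> 2 * mult i1 x u <= cut i1 [set x]) ->
  (M %| r1 x)%Z ->
  (forall S, S \subset W :\ z -> S != W :\ z -> (1 < #|S|)%N -> C0 < cut i S) ->
  2 * (C1 + K) + cut i [set x] <= 2 * C0 + 2 ->
  exists phi', solves i W r z phi phi'.
Proof.
move=> adm IH xW xz st i1 r1 hQ hy hpar hm hrx hS hC.
have h1 : forall e, edgev W (i1 e) := edgev_erase Q (adm_edge adm).
have zW := adm_z adm.
have [j [j1 j2 j3 j4 [j5 j6]]] := lift_all K h1 xW zW xz hpar hm.
have i1z e : i1 e z = i e z.
  by rewrite /i1 /erase; case: ifP => // /hQ[_ ->].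
have r1z : r1 z = r z.
  by rewrite /r1 big1 ?subr0 // => e /hQ[_ ->]; rewrite mulr0.
have jW e : edgev (W :\ x) (j e) := edgev_del xW (j2 e) (j1 e).
have sW : W :\ x \subset W := subD1set _ _.
suff admj : admissible j (W :\ x) r1 z phi.
  have [|phi' [s a f]] := IH _ _ _ _ _ _ admj; first by rewrite [X in (_ < X)%N](cardsD1 x) xW.
  (* No edge is left at [x], so its balance holds exactly because the remaining demand is 0 modulo
     [M]. *)
  have sj : solves j W r1 z phi phi'.
    split=> // v vW; have [->|nvx] := eqVneq v x; last by apply: f; rewrite !inE nvx.
    rewrite /outflow big1 => [|e _]; [by rewrite sub0r rpredN | by rewrite j2 mulr0].
  have [phi1 s1] := j6 _ _ _ sj.
  by apply: (solves_erase st _ s1) => e /hQ[].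
split.
- by [].
- by rewrite !inE eq_sym xz.
- have e1 : vsum r1 W = vsum r W := vsum_erase Q r tau (adm_edge adm).
  have -> : vsum r1 (W :\ x) = vsum r W - r1 x by rewrite -e1 (vsumD1 _ xW); ring.
  by apply: rpredB => //; exact: adm_sum adm.
- move=> v; rewrite !inE => /andP[nvx vW]; rewrite j3 //.
  exact: erase_parity (adm_edge adm) vW st (adm_parity adm vW).
- rewrite j3 // 1?eq_sym // cut_erase big1 ?subr0 ?(adm_deg adm) // => e /hQ[_ ez].
  by rewrite vsum1 ez normr0.
- rewrite r1z; suff -> : outflow phi j z = outflow phi i z by exact: adm_bd adm.
  by apply: eq_bigr => e _; rewrite j5 i1z.
- exact: adm_signs adm.
move=> S sS nS0 nS.
have xS : x \notin S by apply/negP=> /(subsetP sS); rewrite !inE eqxx andbF.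
have zS : z \notin S by apply/negP=> /(subsetP sS); rewrite !inE eqxx.
have sSW : S \subset W by apply: subset_trans sS _; apply: subset_trans (subD1set _ _) sW.
have sSz : S \subset W :\ z by rewrite subsetD1 sSW.
have [le1|lt1] := leqP #|S| 1.
  have /cards1P[y ey] : #|S| == 1%N by rewrite eqn_leq le1 card_gt0.
  have /andP[nyx /andP[nyz yW]] : (y != x) && ((y != z) && (y \in W)).
    by have := subsetP sS y; rewrite ey !inE eqxx => /(_ isT)/and3P[-> -> ->].
  by rewrite ey vsum1 j3 //; apply: hy.
apply: le_trans (j4 S sSW xS).
(* The erased edges all end at [x], so the number of edges avoiding [x] is unchanged. *)
have eA : \sum_e (1 - `|i1 e x|) * `|vsum (i1 e) S| = \sum_e (1 - `|i e x|) * `|vsum (i e) S|.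
  apply: eq_bigr => e _; rewrite /i1 /erase; case: ifP => // /hQ[nx _].
  rewrite vsum0 normr0 mulr0.
  by case: (edgev_unit (adm_edge adm e) xW nx) => ->; rewrite subrr mul0r.
rewrite eA; have := cut_add1 (adm_edge adm) xW sSW xS.
set a := \sum_e _ => ea.
have cS : C0 < cut i S.
  apply: hS => //; apply: contraNneq xS => ->; by rewrite !inE xz.
have cSx : C0 < cut i (x |: S).
  apply: hS.
  - by apply/subsetP=> v; rewrite !inE => /orP[/eqP->|/(subsetP sSz)]; rewrite ?xz ?xW ?inE.
  - apply: contra nS => /eqP eS; rewrite eqEsubset sS /=; apply/subsetP=> w.
    rewrite !inE => /and3P[nwz nwx wW]; have : w \in x |: S by rewrite eS !inE nwz.
    by rewrite !inE (negPf nwx).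
  - by rewrite cardsU1 xS; move: lt1; clear; lia.
have /andP[_ gK] := dist_range (vsum r1 S).
by move: hC cS cSx ea gK; clear; lia.
Qed.

(** [x] wants flow out and [y] wants flow in, so directing one edge from [x] to [y] lowers both
    distances along with both degrees. Larger sets lose at most one from a cut above [C0]. *)
Lemma orient_edge i W r z phi x y : admissible i W r z phi ->
  (forall i' r', (#|[set e | [exists v, i' e v != 0]]| < #|[set e | [exists v, i e v != 0]]|)%N ->
    admissible i' W r' z phi -> exists phi', solves i' W r' z phi phi') ->
  (forall S, S \subset W :\ z -> S != W :\ z -> (1 < #|S|)%N -> C0 < cut i S) ->
  (forall x, x \in W -> x != z -> cut i [set x] = C1 + g (r x)) ->
  x \in W -> x != z -> y \in W -> y != z -> x != y -> 0 < mult i x y ->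
  0 < g (r x) -> 0 < g (r y) -> (M %| r x - g (r x))%Z -> (M %| r y + g (r y))%Z ->
  exists phi', solves i W r z phi phi'.
Proof.
move=> adm IH hC hD xW xz yW yz nxy mxy gx gy tx ty.
have [e [nx ny]] := mult_pos mxy.
have ux := edgev_unit (adm_edge adm e) xW nx.
have [u uW [eu e0]] := other_end (adm_edge adm e) xW nx.
have euy : y = u by apply/eqP/negPn/negP=> n; move: ny; rewrite e0 ?eqxx // eq_sym.
have ey : i e y = - i e x by rewrite euy.
(* With the value [i e x] the edge sends one unit out of [x], whatever its reference direction. *)
have st : signs (fun _ : E => i e x) by [].
have ez : i e z = 0 by apply: e0; rewrite ?(adm_z adm) -?euy 1?eq_sym.
have hQ e' : e' \in [set e] -> i e' z = 0 by rewrite inE => /eqP->.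
set i1 := erase i [set e]; set r1 := fun v => r v - \sum_(e' in [set e]) i e x * i e' v.
have r1E v : r1 v = r v - i e x * i e v by rewrite /r1 big_set1.
have c1E S : cut i1 S = cut i S - `|vsum (i e) S| by rewrite cut_erase big_set1.
suff adm1 : admissible i1 W r1 z phi.
  have [|phi' s1] := IH i1 r1 _ adm1; last exact: solves_erase st hQ s1.
  apply/proper_card/properP; split; last first.
    exists e; rewrite in_set; first by apply/existsP; exists x.
    by apply/existsPn=> v; rewrite /i1 /erase set11 eqxx.
  apply/subsetP=> e'; rewrite !in_set /i1 /erase => /existsP[v].
  by case: ifP => // _ h; apply/existsP; exists v.
have zW := adm_z adm.
split=> //.
- exact: edgev_erase (adm_edge adm).
- have -> : vsum r1 W = vsum r W := vsum_erase [set e] r (fun=> i e x) (adm_edge adm).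
  exact: adm_sum adm.
- by move=> v vW; apply: erase_parity (adm_edge adm) vW st (adm_parity adm vW).
- by rewrite c1E vsum1 ez normr0 subr0; exact: adm_deg adm.
- rewrite r1E ez mulr0 subr0.
  suff -> : outflow phi i1 z = outflow phi i z by exact: adm_bd adm.
  apply: eq_bigr => e' _; rewrite /i1 /erase; case: ifP => // /set1P->.
  by rewrite ez.
- exact: adm_signs adm.
move=> S sS nS0 nS.
have sSW : S \subset W := subset_trans sS (subD1set _ _).
have [le1|lt1] := leqP #|S| 1.
  have /cards1P[v ev] : #|S| == 1%N by rewrite eqn_leq le1 card_gt0.
  have /andP[nvz vW] : (v != z) && (v \in W).
    by have := subsetP sS v; rewrite ev !inE eqxx => /(_ isT).
  rewrite ev vsum1 c1E vsum1 hD //.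
  have [evx|nvx] := eqVneq v x.
    have e2 : r1 x = r x - 1 by rewrite r1E; move: ux; clear; case=> ->; lia.
    have := distD (or_introl erefl) _ gx e2; rewrite mul1r => /(_ tx).
    by rewrite evx; move: ux; clear; case=> ->; lia.
  have [evy|nvy] := eqVneq v y.
    have e2 : r1 y = r y - (-1) by rewrite r1E ey; move: ux; clear; case=> ->; lia.
    have := distD (or_intror erefl) _ gy e2; rewrite mulN1r opprK => /(_ ty).
    by rewrite evy ey; move: ux; clear; case=> ->; lia.
  have ev0 : i e v = 0 by apply: e0; rewrite -?euy.
  by rewrite r1E ev0 normr0 mulr0 !subr0.
have /andP[_ gK] := dist_range (vsum r1 S).
have := hC S sS nS lt1; have := proj1 (adm_edge adm e) S sSW.
by rewrite c1E; move: gK C0E C1_K K_gt0; clear; lia.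
Qed.

(** The surplus degree at [x] is even, since [C1] is even and degree, demand and distance have equal
    parity. Hence it is at least two, exactly what one splitting costs; larger cuts exceed [C0] and
    can lose two. *)
Lemma lift_one i W r z phi x : admissible i W r z phi ->
  (forall i' r', (#|[set e | [exists v, i' e v != 0]]| < #|[set e | [exists v, i e v != 0]]|)%N ->
    admissible i' W r' z phi -> exists phi', solves i' W r' z phi phi') ->
  (forall S, S \subset W :\ z -> S != W :\ z -> (1 < #|S|)%N -> C0 < cut i S) ->
  (forall x y, x \in W -> x != z -> y \in W -> y != z -> x != y -> mult i x y < K) ->
  x \in W -> x != z -> 2 * mult i x z < cut i [set x] -> C1 + g (r x) < cut i [set x] ->
  exists phi', solves i W r z phi phi'.
Proof.
move=> adm IH hC hB xW xz mz cx; have zW := adm_z adm.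
have h := adm_edge adm.
have dm := deg_mult h xW.
have zWx : z \in W :\ x by rewrite !inE eq_sym xz.
have /andP[g0 _] := dist_range (r x).
(* A vertex carrying less than half of the edges at [x] is not the only neighbour. This is used to
   avoid [z], then to avoid the neighbour just found. *)
have other w : w \in W :\ x -> 2 * mult i x w < cut i [set x] ->
    exists2 y, y \in W :\ x & (y != w) && (0 < mult i x y).
  move=> wW mw.
  case: (pickP (fun y => (y \in W :\ x) && ((y != w) && (0 < mult i x y)))) => [y /andP[]|no].
    by exists y.
  move: mw (mult_ge0 i x w); rewrite dm (bigD1 w) //= big1 => [|v /andP[vW nv]].
    by clear; lia.
  by move: (no v) (mult_ge0 i x v); rewrite vW nv /=; clear; lia.
have [y yW /andP[nyz py]] := other z zWx mz.
have [a aW /andP[nay pa]] : exists2 a, a \in W :\ x & (a != y) && (0 < mult i x a).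
  apply: other => //; move: yW; rewrite !inE => /andP[nyx yW].
  have := hB x y xW xz yW nyz; rewrite eq_sym => /(_ nyx).
  by move: cx g0 C1_K K_gt0; clear; lia.
have [e1 [e1x e1a]] := mult_pos pa; have [e2 [e2x e2y]] := mult_pos py.
have L := liftable_ends h xW zW xz aW yW nay nyz e1x e1a e2x e2y.
suff adm1 : admissible (split_off i e1 e2 x) W r z phi.
  have [|phi' s1] := IH _ _ _ adm1; last by have := solves_lift L s1.
  exact: proper_card (support_lift L).
have par := adm_parity adm.
split=> //.
- exact: edgev_lift L.
- exact: adm_sum adm.
- move=> v vW; have [->|nvx] := eqVneq v x; last by rewrite (cut_lift_other L) // par.
  by rewrite (cut_lift_x L); move: (par x xW); clear; lia.
- by rewrite (cut_lift_other L) // 1?eq_sym //; exact: adm_deg adm.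
- suff -> : outflow phi (split_off i e1 e2 x) z = outflow phi i z by exact: adm_bd adm.
  by apply: eq_bigr => e _; rewrite (lift_at_z L).
- exact: adm_signs adm.
move=> S sS nS0 nS.
have sSW : S \subset W := subset_trans sS (subD1set _ _).
have [le1|lt1] := leqP #|S| 1.
  have /cards1P[v ev] : #|S| == 1%N by rewrite eqn_leq le1 card_gt0.
  have /andP[nvz vW] : (v != z) && (v \in W).
    by have := subsetP sS v; rewrite ev !inE eqxx => /(_ isT).
  have [evx|nvx] := eqVneq v x; last first.
    rewrite ev (cut_lift_other L) // -ev; exact: adm_cut adm _ sS nS0 nS.
  rewrite ev evx vsum1 (cut_lift_x L).
  by move: (par x xW) (dist_parity (r x)) C1_even cx; clear; lia.
have /andP[_ gK] := dist_range (vsum r S).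
have := hC S sS nS lt1; have := cut_lift_ge L sSW.
by move: gK C0E C1_K K_gt0; clear; lia.
Qed.

End Reductions.

(** * The minimal counterexample and the orientation theorem *)

Section Induction.
Variables (K C0 C1 : int).
Hypotheses (K_gt0 : 0 < K) (C0E : C0 = 2 * C1 - 2 * K) (C1_even : (2 %| C1)%Z).
Hypotheses (C1_K : 16 * K <= C1) (C1_K2 : 4 * K * K <= C1).
Notation M := (2 * K).
Notation g := (dist_mod M).
Variables (V E : finType).
Implicit Types (f r : V -> int) (S T W : {set V}) (i : E -> V -> int) (phi : E -> int).
Notation admissible := (admissible K C0 C1).
Notation solves := (solves K).
Notation solvable_below := (@solvable_below K C0 C1 V E).

Lemma solve_trivial i W r z phi : admissible i W r z phi -> (#|W :\ z| <= 1)%N ->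
  solves i W r z phi phi.
Proof.
move=> adm hW; split=> //; first exact: adm_signs adm.
have zW := adm_z adm; move=> v vW; have [->|nvz] := eqVneq v z; first exact: adm_bd adm.
have vO : v \in W :\ z by rewrite !inE nvz.
have eO : W :\ z = [set v].
  by apply/eqP; rewrite eq_sym eqEcard sub1set vO cards1.
have e0 : outflow phi i z + outflow phi i v = 0.
  rewrite -[outflow phi i v]vsum1 -eO -vsumD1 // vsum_outflow big1 // => e _.
  by rewrite (proj2 (adm_edge adm e)) mulr0.
have e1 : vsum r W = r z + r v by rewrite (vsumD1 _ zW) eO vsum1.
have -> : outflow phi i v - r v = - (outflow phi i z - r z) - vsum r W.
  by rewrite e1; move: e0; clear; lia.
by apply: rpredB (adm_sum adm); rewrite rpredN; exact: adm_bd adm.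
Qed.

Lemma mult_erase i (Q : {set E}) x u :
  mult (erase i Q) x u = mult i x u - \sum_(e in Q) `|i e x| * `|i e u|.
Proof. by rewrite /mult (sum_erase i Q (F := fun e f => `|f x| * `|f u|)) // => e; rewrite normr0 mul0r. Qed.

Lemma edge_ends i W x y e : (forall e, edgev W (i e)) -> x \in W -> y \in W -> y != x ->
  i e x != 0 -> i e y != 0 ->
  [/\ i e x = 1 \/ i e x = -1, i e y = - i e x &
      forall w, w \in W -> w != x -> w != y -> i e w = 0].
Proof.
move=> h xW yW nyx nx ny; have [u uW [eu e0]] := other_end (h e) xW nx.
have eyu : y = u by apply/eqP/negPn/negP=> n; move: ny; rewrite e0 ?eqxx.
by split; [exact: edgev_unit (h e) xW nx | rewrite eyu | rewrite eyu].
Qed.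

Section Step.
Variables (i : E -> V -> int) (W : {set V}) (r : V -> int) (z : V) (phi : E -> int).
Hypothesis adm : admissible i W r z phi.
Hypothesis IHW : solvable_below #|W|.
Hypothesis big_cut : forall S, S \subset W :\ z -> S != W :\ z -> (1 < #|S|)%N -> C0 < cut i S.
Hypothesis small_mult : forall x y,
  x \in W -> x != z -> y \in W -> y != z -> x != y -> mult i x y < K.
Hypothesis mult_z : forall x, x \in W -> x != z -> 2 * mult i x z < cut i [set x].
Hypothesis tight : forall x, x \in W -> x != z -> cut i [set x] = C1 + g (r x).

Let zW : z \in W := adm_z adm.

Let r_parity x : x \in W -> (2 %| cut i [set x] - g (r x))%Z.
Proof.
move=> xW; have := adm_parity adm xW; have := dist_parity K_gt0 (r x).
by clear; lia.
Qed.

Let tight_le x : x \in W -> x != z -> 2 * (C1 + K) + cut i [set x] <= 2 * C0 + 2.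
Proof.
move=> xW xz; rewrite tight // C0E; have /andP[_] := dist_range K_gt0 (r x).
by move: C1_K K_gt0; clear; lia.
Qed.

(** A demand divisible by the modulus is met by letting the flow pass through: all edges at [x] are
    split off and none is oriented ([Q] is empty). *)
Lemma solve_zero x : x \in W -> x != z -> g (r x) = 0 -> exists phi', solves i W r z phi phi'.
Proof.
move=> xW xz gx.
have c0 S : cut (erase i set0) S = cut i S by rewrite cut_erase big_set0 subr0.
have r0 v : r v - \sum_(e in set0) 1 * i e v = r v by rewrite big_set0 subr0.
have st : signs (fun _ : E => 1) by left.
apply: (delete_vertex K_gt0 adm IHW xW xz st (Q := set0)) => //.
- by move=> e; rewrite inE.
- by move=> y yW yz _; rewrite r0 c0 tight.
- by rewrite c0; have := r_parity xW; rewrite gx subr0.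
- move=> u; rewrite !inE => /andP[nux uW]; rewrite c0 mult_erase big_set0 subr0.
  have [->|nuz] := eqVneq u z; first exact/ltW/mult_z.
  have := small_mult xW xz uW nuz; rewrite eq_sym => /(_ nux).
  by rewrite tight // gx; move: C1_K K_gt0; clear; lia.
- rewrite r0; case: (dist_type K_gt0 (r x)); rewrite gx ?subr0 ?addr0 //.
- exact: tight_le.
Qed.

Definition neighbours x := [set y in W | [&& y != z, y != x & 0 < mult i x y]].

(** Less than half of the degree, which is at least [C1], goes to [z], and every other neighbour
    takes fewer than [K] edges. *)
Lemma many_neighbours x : x \in W -> x != z -> C1 < 2 * K * #|neighbours x|%:Z.
Proof.
move=> xW xz.
have : cut i [set x] <= mult i x z + K * #|neighbours x|%:Z.
  rewrite (deg_mult (adm_edge adm) xW) (bigD1 z) /=; last by rewrite !inE eq_sym xz.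
  rewrite lerD2l (bigID (fun y => 0 < mult i x y)) /= [X in _ + X]big1 => [|y]; last first.
    by move=> /andP[_]; have := mult_ge0 i x y; clear; lia.
  rewrite addr0 -sum_const_int (eq_bigl (fun y => y \in neighbours x)) => [|y]; last first.
    by rewrite !inE; case: (y \in W); case: (y == z); case: (y == x); rewrite ?andbF ?andbT.
  apply: ler_sum => y; rewrite in_set => hy; have [yW nyz nyx _] := and4P hy.
  by apply/ltW/small_mult; rewrite // eq_sym.
have /andP[g0 _] := dist_range K_gt0 (r x).
by move: (mult_z xW xz); rewrite tight //; move: g0; clear; lia.
Qed.

Lemma many_ordinary x : x \in W -> x != z -> (8 < #|W :\ z|)%N.
Proof.
move=> xW xz; apply: (@leq_trans #|neighbours x|); last first.
  by apply/subset_leq_card/subsetP=> y; rewrite !inE => /and4P[-> -> _ _].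
have := many_neighbours xW xz; move: (#|_|) => n; move: C1_K K_gt0; clear; nia.
Qed.

(** Otherwise more than eight vertices would each send over [C1] / 4 edges to [z], exceeding its
    degree bound [C0] < 2 [C1]. With at most [C1] / 4 edges to [z], up to 2K other edges at [x] can
    be erased and [z] still has at most half of the rest. *)
Lemma exists_few_z : (1 < #|W :\ z|)%N -> exists2 x, x \in W :\ z & 4 * mult i x z <= C1.
Proof.
move=> hO; case: (pickP (fun x => (x \in W :\ z) && (4 * mult i x z <= C1))) => [x /andP[]|no].
  by exists x.
have /set0Pn[x xO] : W :\ z != set0 by rewrite -card_gt0; apply: ltn_trans hO.
have /andP[xz xW] : (x != z) && (x \in W) by move: xO; rewrite !inE.
have := many_ordinary xW xz; have := adm_deg adm; rewrite (deg_mult (adm_edge adm) zW).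
have : C1 * #|W :\ z|%:Z <= 4 * \sum_(u in W :\ z) mult i z u.
  rewrite -sum_const_int mulr_sumr; apply: ler_sum => u uO; rewrite multC.
  by move: (no u); rewrite uO; clear; lia.
move: (\sum_(_ in _) _) (#|_|) => a n; move: C0E C1_K K_gt0; clear; nia.
Qed.

Hypothesis dist_gt0 : forall x, x \in W -> x != z -> 0 < g (r x).
Hypothesis no_opposite : forall x y, x \in W -> x != z -> y \in W -> y != z -> x != y ->
  0 < mult i x y -> (M %| r x - g (r x))%Z -> (M %| r y + g (r y))%Z -> False.

(* All demands near x have the same sign s, so M - g (r x) edges from distinct
   neighbours into x can be oriented at no cost to these neighbours; the remaining
   edges at x are split off. *)
Lemma solve_nonzero : (1 < #|W :\ z|)%N -> exists phi', solves i W r z phi phi'.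
Proof.
move=> hO; have h := adm_edge adm.
have [x] := exists_few_z hO; rewrite !inE => /andP[xz xW] mz.
have [s hs tx] : exists2 s : int, s = 1 \/ s = -1 & (M %| r x - s * g (r x))%Z.
  case: (dist_type K_gt0 (r x)) => t; [exists 1|exists (-1)]; rewrite ?mul1r ?mulN1r ?opprK //.
  - by left.
  - by right.
have ty y : y \in neighbours x -> (M %| r y - s * g (r y))%Z.
  rewrite inE => /and4P[yW yz yx m0]; have nxy : x != y by rewrite eq_sym.
  case: hs tx => -> tx; case: (dist_type K_gt0 (r y)) => // t; rewrite ?mul1r ?mulN1r ?opprK //.
    by case: (no_opposite xW xz yW yz nxy m0 _ t); rewrite -[g (r x)]mul1r.
  rewrite mulN1r opprK in tx; case: (no_opposite yW yz xW xz yx _ t tx); by rewrite multC.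
have /andP[gx0 gxK] := dist_range K_gt0 (r x).
(* Serving [x] directly by g edges would push its neighbours away from the multiples of [M]. Instead
   [x] goes the long way round: M - g units of sign [-s] turn [s * g] into a multiple of [M], and
   each chosen neighbour gets a unit of its own sign. Enough neighbours exist since 4 [K] * [K] <=
   [C1]. *)
have [Y sY cY] : exists2 Y : {set V}, Y \subset neighbours x & #|Y| = `|M - g (r x)|%N.
  apply: exists_subset_card; have := many_neighbours xW xz; move: (#|_|) => n.
  by move: gx0 gxK C1_K2 K_gt0; clear; nia.
have cYz : #|Y|%:Z = M - g (r x) by rewrite cY; move: gxK K_gt0; clear; lia.
have Yin y : y \in Y -> [/\ y \in W, y != z, y != x & 0 < mult i x y].
  by move/(subsetP sY); rewrite inE => /and4P[].
have [e0 _] : exists e0 : E, True.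
  have : (0 < #|Y|)%N by move: cYz gxK K_gt0; clear; lia.
  by rewrite card_gt0 => /set0Pn[y /Yin[_ _ _ /mult_pos[e _]]]; exists e.
pose ey y := odflt e0 [pick e | (i e x != 0) && (i e y != 0)].
have eyP y : y \in Y -> [/\ i (ey y) x = 1 \/ i (ey y) x = -1, i (ey y) y = - i (ey y) x &
    forall w, w \in W -> w != x -> w != y -> i (ey y) w = 0].
  move=> /Yin[yW yz yx m0]; rewrite /ey; case: pickP => [e /andP[n1 n2]|no] /=.
    exact: edge_ends h xW yW yx n1 n2.
  by have [e [n1 n2]] := mult_pos m0; move: (no e); rewrite n1 n2.
have ey_inj : {in Y &, injective ey}.
  move=> y y' yY y'Y eyy; apply/eqP/negPn/negP=> nyy'.
  have [hu ee _] := eyP y yY; have [_ _ e3] := eyP y' y'Y.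
  have [yW _ yx _] := Yin y yY.
  by move: ee; rewrite eyy e3 //; case: hu; rewrite eyy => ->.
pose Q := ey @: Y.
pose tau e : int := if i e x == 0 then 1 else - s * i e x.
have st : signs tau.
  move=> e; rewrite /tau; case: eqP => [_|/eqP nx]; first by left.
  by case: (edgev_unit (h e) xW nx) => ->; case: hs => ->; [right|left|left|right].
have sumQ (F : E -> int) : \sum_(e in Q) F e = \sum_(y in Y) F (ey y) by rewrite big_imset.
have QP e : e \in Q -> exists2 y, y \in Y & e = ey y by case/imsetP=> y; exists y.
have nz1 (a : int) : a = 1 \/ a = -1 -> a != 0 by case=> ->.
have norm1 (a : int) : a = 1 \/ a = -1 -> `|a| = 1 by case=> ->.
have taux y : y \in Y -> tau (ey y) * i (ey y) x = - s.
  move=> /eyP[hu _ _]; rewrite /tau (negPf (nz1 _ hu)).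
  by case: hu => ->; ring.
have at_w w (F : E -> int) c : w \in W -> w != x ->
    (forall y, y \in Y -> i (ey y) w = 0 -> F (ey y) = 0) ->
    (w \in Y -> F (ey w) = c) -> \sum_(e in Q) F e = c * (w \in Y)%:Z.
  move=> wW wx F0 F1; rewrite sumQ; have [wY|wY] := boolP (w \in Y).
    rewrite (bigD1 w) //= F1 // big1 ?addr0 ?mulr1 // => y /andP[yY nyw].
    by apply: F0 => //; have [_ _ ->] := eyP y yY; rewrite // eq_sym.
  rewrite big1 ?mulr0 // => y yY; apply: F0 => //.
  by have [_ _ ->] := eyP y yY => //; apply: contraNneq wY => ->.
have cutQ w : w \in W -> w != x -> cut (erase i Q) [set w] = cut i [set w] - (w \in Y)%:Z.
  move=> wW wx; rewrite cut_erase (at_w w _ 1) ?mul1r //.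
    by move=> y yY; rewrite vsum1 => ->; rewrite normr0.
  by move=> wY; rewrite vsum1; have [hu -> _] := eyP w wY; rewrite normrN norm1.
have cutx : cut (erase i Q) [set x] = cut i [set x] - #|Y|%:Z.
  rewrite cut_erase sumQ (eq_bigr (fun=> 1)) ?sum_const_int ?mul1r // => y yY.
  by rewrite vsum1; have [hu _ _] := eyP y yY; rewrite norm1.
have rx : r x - \sum_(e in Q) tau e * i e x = r x + s * #|Y|%:Z.
  rewrite sumQ (eq_bigr (fun=> - s)) ?sum_const_int; last exact: taux.
  by ring.
have rw w : w \in W -> w != x -> r w - \sum_(e in Q) tau e * i e w = r w - s * (w \in Y)%:Z.
  move=> wW wx; rewrite (at_w w _ s) //.
    by move=> y yY ->; rewrite mulr0.
  by move=> wY; have [_ -> _] := eyP w wY; rewrite mulrN taux ?opprK.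
have bigC : 16 * K <= cut i [set x] by rewrite tight //; move: gx0 C1_K; clear; lia.
apply: (delete_vertex K_gt0 adm IHW xW xz st (Q := Q)) => //.
- move=> e /QP[y yY ->]; have [hu _ e3] := eyP y yY; have [_ yz _ _] := Yin y yY.
  by split; [exact: nz1 | apply: e3 => //; rewrite eq_sym].
- move=> y yW yz yx; rewrite rw // cutQ // tight //.
  have [yY|yY] := boolP (y \in Y); last by rewrite mulr0 !subr0.
  have := distD K_gt0 hs (ty y (subsetP sY _ yY)) (dist_gt0 yW yz) erefl.
  by rewrite mulr1; clear; lia.
- rewrite cutx cYz; have := r_parity xW.
  by move: (cut _ _) (dist_mod _ _) => a d; clear; lia.
- move=> u; rewrite !inE => /andP[nux uW]; rewrite cutx cYz mult_erase.
  have : 0 <= \sum_(e in Q) `|i e x| * `|i e u| by apply: sumr_ge0 => e _; rewrite mulr_ge0.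
  move: (\sum_(_ in _) _) => a a0.
  have [->|nuz] := eqVneq u z.
    by rewrite tight //; move: a0 mz gx0 C1_K K_gt0; clear; lia.
  have := small_mult xW xz uW nuz; rewrite eq_sym => /(_ nux).
  by move: bigC a0 gx0 K_gt0; clear; lia.
- rewrite rx cYz; have -> : r x + s * (M - g (r x)) = (r x - s * g (r x)) + s * M by ring.
  by apply: rpredD => //; rewrite dvdz_mull.
- exact: tight_le.
Qed.

End Step.

Theorem admissible_solvable i W r z phi : admissible i W r z phi ->
  exists phi', solves i W r z phi phi'.
Proof.
have [n] := ubnP #|W|; elim: n i W r z phi => // n IHn i W r z phi hn.
have IHW : solvable_below #|W|.
  by move=> i' W' r' z' phi' lt; apply: IHn; apply: leq_trans lt _; rewrite -ltnS.
(* An inner induction on the number of nonzero edges, for the reductions that keep the vertex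
   set. *)
have [k] := ubnP #|[set e | [exists v, i e v != 0]]|.
elim: k i r => // k IHk i r hk adm.
have IHi i' r' : (#|[set e | [exists v, i' e v != 0]]| < #|[set e | [exists v, i e v != 0]]|)%N ->
    admissible i' W r' z phi -> exists phi', solves i' W r' z phi phi'.
  by move=> lt; apply: IHk; apply: leq_trans lt _; rewrite -ltnS.
have h := adm_edge adm; have zW := adm_z adm.
have [le1|gt1] := leqP #|W :\ z| 1; first by exists phi; apply: solve_trivial.
case: (pickP (fun p : V * V => [&& p.1 \in W :\ z, p.2 \in W :\ z, p.1 != p.2 & K <= mult i p.1 p.2])).
  by case=> x y /= /and4P[xO yO nxy hm]; exact: (solve_parallel K_gt0 adm IHW xO yO nxy hm).
move=> noB.
have hB x y : x \in W -> x != z -> y \in W -> y != z -> x != y -> mult i x y < K.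
  move=> xW xz yW yz nxy; move: (noB (x, y)); rewrite /= !inE xW xz yW yz nxy /=.
  by rewrite leNgt => /negbFE.
case: (pickP (fun S : {set V} => [&& S \subset W :\ z, S != W :\ z, (1 < #|S|)%N & cut i S <= C0])).
  by move=> S /and4P[sS nS cS dS]; exact: (solve_small_cut adm IHW sS nS cS dS).
move=> noC.
have hC S : S \subset W :\ z -> S != W :\ z -> (1 < #|S|)%N -> C0 < cut i S.
  by move=> sS nS cS; move: (noC S); rewrite sS nS cS /= leNgt => /negbFE.
have lo x : x \in W -> x != z -> C1 + g (r x) <= cut i [set x].
  move=> xW xz; rewrite -vsum1; apply: adm_cut adm _ _ _ _.
  - by rewrite sub1set !inE xz.
  - by apply/set0Pn; exists x; rewrite inE.
  - by apply: contraTneq gt1 => <-; rewrite cards1.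
(* This fixes [C0]: with only [x] and [y] besides [z], the degree of [z] would be the cut around
   both, which exceeds 2 [C1] - 2 [K]. *)
have gt2 : (2 < #|W :\ z|)%N.
  rewrite ltn_neqAle gt1 andbT eq_sym; apply/negP=> /cards2P[x [y [nxy eO]]].
  have : x \in W :\ z by rewrite eO !inE eqxx.
  have : y \in W :\ z by rewrite eO !inE eqxx orbT.
  rewrite !inE => /andP[yz yW] /andP[xz xW].
  have := cut_pair h xW yW nxy; rewrite -eO (cut_compl h) ?sub1set //.
  move: (hB x y xW xz yW yz nxy) (lo x xW xz) (lo y yW yz) (adm_deg adm).
  have /andP[g1 _] := dist_range K_gt0 (r x); have /andP[g2 _] := dist_range K_gt0 (r y).
  by move: g1 g2 C0E; clear; lia.
(* The complement of {x, z} has a cut above [C0], whereas [z] has degree at most [C0]; the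
   difference is what [x] keeps beyond twice its edges to [z]. *)
have hz x : x \in W -> x != z -> 2 * mult i x z < cut i [set x].
  move=> xW xz; have := cut_pair h xW zW xz; have := adm_deg adm.
  have sxz : [set x; z] \subset W by apply/subsetP=> v; rewrite !inE => /orP[]/eqP->.
  rewrite -(cut_compl h sxz).
  have : C0 < cut i (W :\: [set x; z]).
    have e : W :\: [set x; z] = (W :\ z) :\ x by apply/setP=> v; rewrite !inE negb_or andbA.
    have xO : x \in W :\ z by rewrite !inE xz.
    rewrite e; apply: hC; first exact: subD1set.
      by apply: contraTneq xO => <-; rewrite !inE eqxx.
    by move: gt2; rewrite (cardsD1 x) xO.
  by clear; lia.
case: (pickP (fun x => (x \in W :\ z) && (C1 + g (r x) < cut i [set x]))) => [x|noD].
  rewrite !inE => /andP[/andP[xz xW] cx].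
  exact: (lift_one K_gt0 C0E C1_even C1_K adm IHi hC hB xW xz (hz x xW xz) cx).
have hD x : x \in W -> x != z -> cut i [set x] = C1 + g (r x).
  move=> xW xz; apply/eqP; rewrite eq_le lo // andbT leNgt.
  by move: (noD x); rewrite !inE xz xW /= => ->.
case: (pickP (fun x => (x \in W :\ z) && (g (r x) == 0))) => [x|noF].
  by rewrite !inE => /andP[/andP[xz xW] /eqP gx]; exact: (solve_zero adm IHW hC hB hz hD xW xz gx).
have hF x : x \in W -> x != z -> 0 < g (r x).
  move=> xW xz; rewrite lt_def; have /andP[-> _] := dist_range K_gt0 (r x).
  by move: (noF x); rewrite !inE xz xW /= => ->.
case: (pickP (fun p : V * V => [&& p.1 \in W :\ z, p.2 \in W :\ z, p.1 != p.2, 0 < mult i p.1 p.2 &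
    (M %| r p.1 - g (r p.1))%Z && (M %| r p.2 + g (r p.2))%Z])).
  move=> [x y] /=; rewrite !inE => /and5P[/andP[xz xW] /andP[yz yW] nxy m0 /andP[tx ty]].
  exact: (orient_edge K_gt0 C0E C1_K adm IHi hC hD xW xz yW yz nxy m0 (hF x xW xz) (hF y yW yz) tx ty).
move=> noE; apply: (solve_nonzero adm IHW hC hB hz hD hF _ gt1) => x y xW xz yW yz nxy m0 tx ty.
by move: (noE (x, y)); rewrite /= !inE xz xW yz yW nxy m0 tx ty.
Qed.

End Induction.

(** Direct [e] from [s e] to [t e] when [psi e] holds. The out-degree of [v] is the difference below
    plus the number of edges with [t e == v], so prescribing one prescribes the other. *)
Definition orients_modulo (K k : nat) : Prop :=
  forall (V E : finType) (s t : E -> V) (B : {set V}),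
    (forall e, s e \in B /\ t e \in B) ->
    (forall S : {set V}, S \subset B -> S != set0 -> S != B ->
       (k <= #|[set e | (s e \in S) != (t e \in S)]|)%N) ->
  forall r : V -> int, (K%:Z %| \sum_(v in B) r v)%Z ->
  exists psi : E -> bool, forall v, v \in B ->
    (K%:Z %| \sum_(e | s e == v) (psi e)%:Z - \sum_(e | t e == v) (psi e)%:Z - r v)%Z.

(* The induction is started with an isolated extra vertex None in the role of z;
   psi in {0, 1} corresponds to signs 2 * psi - 1, whence the modulus 2 * K. *)
Theorem modular_orientation (K : nat) : (0 < K)%N -> exists k : nat, orients_modulo K k.
Proof.
(* [C1] = 16 * K * K is even and dominates both required lower bounds; the extra [K] covers the
   distance term. *)
move=> K0; exists (16 * K * K + K)%N => V E s t B stB hcut r hr.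
pose i (e : E) (v : option V) : int := (Some (s e) == v)%:Z - (Some (t e) == v)%:Z.
pose W : {set option V} := None |: Some @: B.
pose rr (v : option V) : int := (if v is Some u then 2 * r u else 0) - \sum_e i e v.
have inS (S : {set option V}) a : \sum_(v in S) ((a == v)%:Z : int) = (a \in S)%:Z.
  have [aS|aS] := boolP (a \in S).
    rewrite (bigD1 a) //= eqxx big1 ?addr0 // => v /andP[_ nv].
    by rewrite eq_sym (negPf nv).
  by rewrite big1 // => v vS; case: eqP => // e; rewrite e vS in aS.
have isum e S : vsum (i e) S = (Some (s e) \in S)%:Z - (Some (t e) \in S)%:Z.
  by rewrite /vsum sumrB !inS.
have SomeW v : (Some v \in W) = (v \in B).
  by rewrite !inE /= mem_imset // => x y [].
have iN e : i e None = 0 by [].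
have adm : admissible K%:Z (2 * (16 * K * K)%:Z - 2 * K%:Z) (16 * K * K)%:Z i W rr None (fun=> 1).
  split.
  - move=> e; split=> [S _|]; rewrite isum.
      by case: (_ \in S); case: (_ \in S).
    by rewrite !SomeW; have [-> ->] := stB e.
  - by rewrite !inE.
  - rewrite /vsum sumrB exchange_big /= [X in _ - X]big1 ?subr0; last first.
      move=> e _; have := isum e W; rewrite /vsum => ->.
      by rewrite !SomeW; have [-> ->] := stB e.
    rewrite big_setU1 /=; last by apply/imsetP=> -[].
    rewrite add0r big_imset /=; last by move=> x y _ _ [].
    by rewrite -mulr_sumr dvdz_mul2l.
  - move=> v _; rewrite cut1 /rr.
    have -> : (if v is Some u then 2 * r u else 0) - \sum_e i e v - \sum_e `|i e v| =
      (if v is Some u then 2 * r u else 0) - \sum_e (i e v + `|i e v|) by rewrite -addrA -opprD -big_split.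
    apply: rpredB; first by case: v => // u; rewrite dvdz_mulr.
    apply: dvdz_sum => e _; rewrite /i.
    by case: (_ == v); case: (_ == v).
  - rewrite cut1 big1; [move: K0; clear; nia | by move=> e _; rewrite iN].
  - rewrite /outflow /rr !big1 // => e _; by rewrite iN ?mulr0.
  - by left.
  move=> S sS nS0 nS.
  have /andP[_ gK] := dist_range (K := K%:Z) K0 (vsum rr S).
  apply: (@le_trans _ _ (16 * K * K + K)%N%:Z); first by move: gK; clear; lia.
  pose S0 := [set v | Some v \in S].
  have -> : cut i S = #|[set e | (s e \in S0) != (t e \in S0)]|%:Z.
    rewrite -[RHS]mul1r -sum_const_int [RHS]big_mkcond; apply: eq_bigr => e _.
    by rewrite isum !inE; case: (_ \in S); case: (_ \in S).
  have NS : None \notin S by apply/negP=> /(subsetP sS); rewrite !inE eqxx.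
  apply: hcut.
  - by apply/subsetP=> v; rewrite inE => /(subsetP sS); rewrite in_setD1 SomeW.
  - have /set0Pn[[v|] vS] := nS0; last by rewrite vS in NS.
    by apply/set0Pn; exists v; rewrite inE.
  apply: contra nS => /eqP eB; rewrite eqEsubset sS /=; apply/subsetP=> -[v|].
    by rewrite in_setD1 SomeW -eB inE.
  by rewrite !inE.
have [|||||phi [sg _ hphi]] := admissible_solvable _ _ _ _ _ adm.
- by move: K0; clear; lia.
- by [].
- by move: K0; clear; lia.
- by move: K0; clear; nia.
- by move: K0; clear; nia.
exists (fun e => phi e == 1) => v vB.
have := hphi (Some v); rewrite SomeW => /(_ vB).
have -> : outflow phi i (Some v) - rr (Some v) =
   2 * (\sum_(e | s e == v) (phi e == 1)%:Z - \sum_(e | t e == v) (phi e == 1)%:Z - r v).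
  have -> : outflow phi i (Some v) = 2 * (\sum_e (phi e == 1)%:Z * i e (Some v)) - \sum_e i e (Some v).
    rewrite mulr_sumr -sumrB; apply: eq_bigr => e _.
    by case: (sg e) => ->; rewrite /=; ring.
  have -> : \sum_e (phi e == 1)%:Z * i e (Some v) =
      \sum_(e | s e == v) (phi e == 1)%:Z - \sum_(e | t e == v) (phi e == 1)%:Z.
    rewrite [\sum_(e | s e == v) _]big_mkcond [\sum_(e | t e == v) _]big_mkcond -sumrB.
    apply: eq_bigr => e _; rewrite /i.
    have eS (a b : V) : (Some a == Some b) = (a == b) by [].
    by rewrite !eS; case: (s e == v); case: (t e == v); case: (phi e == 1).
  by rewrite /rr; ring.
by rewrite dvdz_mul2l.
Qed.

Local Close Scope ring_scope.

(** * Matroid intersection and tree packing *)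

Section Matroid.
Variable T : finType.
Implicit Types (r : {set T} -> nat) (X Y D U I : {set T}).

(** Matroids enter through their rank functions only; independence of [I] is expressed by [r I]
    being the size of [I]. *)
Record rank_function r : Prop := RankFunction {
  rank0 : r set0 = 0;
  rankU1 : forall x X, r (x |: X) <= (r X).+1;
  rankS : forall X Y, X \subset Y -> r X <= r Y;
  rankUI : forall X Y, r (X :|: Y) + r (X :&: Y) <= r X + r Y }.

Lemma rank_contract r x : rank_function r -> r [set x] = 1 ->
  rank_function (fun X => (r (x |: X)).-1).
Proof.
move=> rf rx.
have ge1 X : 0 < r (x |: X).
  by rewrite -rx; apply: rankS => //; apply: subsetUl.
split=> [|y X|X Y sXY|X Y].
- by rewrite setU0 rx.
- by rewrite setUCA; have := rankU1 rf y (x |: X); have := ge1 X; clear; lia.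
- by have := rankS rf (setUS [set x] sXY); clear; lia.
have := rankUI rf (x |: X) (x |: Y); rewrite -setUUr -setUIr.
by move: (ge1 (X :|: Y)) (ge1 (X :&: Y)) (ge1 X) (ge1 Y); clear; lia.
Qed.

(* If neither deleting nor contracting e works, two violating sets U and X uncross
   to sets that violate the hypothesis. *)
Theorem matroid_intersection r1 r2 D k : rank_function r1 -> rank_function r2 ->
  (forall U, U \subset D -> k <= r1 U + r2 (D :\: U)) ->
  exists I, [/\ I \subset D, #|I| = k, r1 I = k & r2 I = k].
Proof.
have [n] := ubnP #|D|; elim: n D r1 r2 k => // n IH D r1 r2 k hn rf1 rf2 hk.
have [D0|/set0Pn[e eD]] := eqVneq D set0.
  exists set0; have := hk set0 (sub0set _).
  rewrite D0 setD0 cards0 (rank0 rf1) (rank0 rf2) leqn0 => /eqP->.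
  by rewrite sub0set.
have k0 : k = 0 -> exists I, [/\ I \subset D, #|I| = k, r1 I = k & r2 I = k].
  by move=> ->; exists set0; rewrite cards0 (rank0 rf1) (rank0 rf2) sub0set.
pose D' := D :\ e.
have hn' : #|D'| < n by move: hn; rewrite (cardsD1 e D) eD.
have sD' : D' \subset D := subD1set _ _.
have eU U : U \subset D' -> e \notin U.
  by move=> sU; apply/negP=> /(subsetP sU); rewrite !inE eqxx.
have del : (forall U, U \subset D' -> k <= r1 U + r2 (D' :\: U)) ->
    exists I, [/\ I \subset D, #|I| = k, r1 I = k & r2 I = k].
  move=> hk'; have [I [sI cI i1 i2]] := IH D' r1 r2 k hn' rf1 rf2 hk'.
  by exists I; split=> //; apply: subset_trans sI sD'.
have r_loop r x X : rank_function r -> r [set x] = 0 -> r (x |: X) <= r X.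
  by move=> rf rx; have := rankUI rf [set x] X; rewrite rx; clear; lia.
have le1 r x : rank_function r -> r [set x] <= 1.
  by move=> rf; have := rankU1 rf x set0; rewrite setU0 (rank0 rf).
have DU U : U \subset D' -> D :\: U = e |: (D' :\: U).
  move=> sU; apply/setP=> y; rewrite !inE; case: eqP => // ->.
  by rewrite eD eU.
have DeU U : D :\: (e |: U) = D' :\: U.
  by apply/setP=> y; rewrite !inE; case: (y == e); rewrite ?andbF.
(* A loop of either matroid is simply deleted: putting it back does not raise that rank. *)
case: (posnP (r1 [set e])) => [z1|p1].
  apply: del => U sU; rewrite -DeU; apply: leq_trans (hk (e |: U) _) _.
    by rewrite subUset sub1set eD (subset_trans sU).
  by rewrite leq_add2r r_loop.
case: (posnP (r2 [set e])) => [z2|p2].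
  apply: del => U sU; apply: leq_trans (hk U (subset_trans sU sD')) _.
  by rewrite leq_add2l DU // r_loop.
have o1 : r1 [set e] = 1 by apply/eqP; rewrite eqn_leq le1.
have o2 : r2 [set e] = 1 by apply/eqP; rewrite eqn_leq le1.
case: (pickP (fun U => (U \subset D') && (r1 U + r2 (D' :\: U) < k))) => [U /andP[sU hU]|no]; last first.
  by apply: del => U sU; move: (no U); rewrite sU /= ltnNge => /negbFE.
pose q1 X := (r1 (e |: X)).-1; pose q2 X := (r2 (e |: X)).-1.
have ge X r : rank_function r -> r [set e] = 1 -> 0 < r (e |: X).
  by move=> rf <-; apply: rankS => //; apply: subsetUl.
case: (pickP (fun X => (X \subset D') && (q1 X + q2 (D' :\: X) < k.-1))) => [X /andP[sX hX]|no]; last first.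
  have [|I [sI cI i1 i2]] := IH D' q1 q2 k.-1 hn' (rank_contract rf1 o1) (rank_contract rf2 o2).
    by move=> X sX; move: (no X); rewrite sX /= ltnNge => /negbFE.
  have [k00|kpos] := posnP k; first exact: k0.
  exists (e |: I); split.
  - by rewrite subUset sub1set eD (subset_trans sI).
  - by rewrite cardsU1 (eU _ sI) cI; move: kpos; clear; lia.
  - by move: i1 (ge I r1 rf1 o1) kpos; rewrite /q1; clear; lia.
  - by move: i2 (ge I r2 rf2 o2) kpos; rewrite /q2; clear; lia.
(* The violations bound the four ranks by 2k - 1 in total, because contraction lowers two ranks by
   one each but [k] only once. By submodularity the hypothesis at [U :&: X] and at [e |: (U :|: X)]
   gives at least 2k. *)
exfalso; move: hX; rewrite /q1 /q2 => hX.
have := rankUI rf1 U (e |: X).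
have -> : U :&: (e |: X) = U :&: X.
  apply/setP=> y; rewrite !inE; case: eqP => // ->.
  by rewrite (negPf (eU _ sU)).
rewrite setUCA => h1.
have := rankUI rf2 (D' :\: U) (e |: (D' :\: X)).
have -> : (D' :\: U) :|: (e |: (D' :\: X)) = D :\: (U :&: X).
  rewrite DU; last by apply: subset_trans (subsetIl _ _) sU.
  by apply/setP=> y; rewrite !inE; case: (y == e) => //=; case: (y \in D); case: (y \in U); case: (y \in X).
have -> : (D' :\: U) :&: (e |: (D' :\: X)) = D :\: (e |: (U :|: X)).
  rewrite DeU; apply/setP=> y; rewrite !inE; case: eqP => //= [->|_]; rewrite ?eqxx ?andbF //.
  by case: (y \in U); case: (y \in X); case: (y \in D).
move=> h2.
have hI : U :&: X \subset D by apply: subset_trans (subsetIl _ _) (subset_trans sU sD').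
have hU' : e |: (U :|: X) \subset D.
  by rewrite !subUset sub1set eD (subset_trans sU) ?(subset_trans sX).
move: (hk _ hI) (hk _ hU') h1 h2 hX hU (ge X r1 rf1 o1) (ge (D' :\: X) r2 rf2 o2).
by clear; lia.
Qed.

End Matroid.

(** * The graphic matroid *)

Section GraphicRank.
Variables (V E : finType) (s t : E -> V).
Implicit Types (S : {set V}) (F D : {set E}).
Local Open Scope ring_scope.

Notation vec := {ffun V -> rat^o}.
Notation crosses e S := ((s e \in S) != (t e \in S)).

Definition delta (v : V) : vec := [ffun w => (w == v)%:R].
Definition edge_vec e : vec := delta (s e) - delta (t e).
Definition edge_span F : {vspace vec} := (\sum_(e in F) <[edge_vec e]>)%VS.
(** The graphic rank as the rank of oriented incidence vectors over the rationals, so that the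
    matroid axioms are dimension formulas. The dimension [n] of the whole space stands for the
    number of vertices and is never evaluated. *)
Definition grank F : nat := \dim (edge_span F).
Notation n := (\dim (fullv : {vspace vec})).

Lemma sum_delta S v : \sum_(w in S) delta v w = (v \in S)%:R.
Proof.
have [vS|vS] := boolP (v \in S).
  by rewrite (bigD1 v) //= big1 ?ffunE ?eqxx ?addr0 // => w /andP[_ /negPf nw]; rewrite ffunE nw.
by rewrite big1 // => w wS; rewrite ffunE; case: eqP => // e; rewrite -e wS in vS.
Qed.

Lemma sum_edge_vec S e : \sum_(w in S) edge_vec e w = (s e \in S)%:R - (t e \in S)%:R.
Proof. by rewrite -!sum_delta -sumrB; apply: eq_bigr => v _; rewrite !ffunE. Qed.

Lemma edge_vec_span F e : e \in F -> edge_vec e \in edge_span F.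
Proof. by move=> eF; apply: (subvP (sumv_sup e eF (subvv _))); apply: memv_line. Qed.

Lemma sum_edge_span F S x : (forall e, e \in F -> ~~ crosses e S) -> x \in edge_span F ->
  \sum_(v in S) x v = 0.
Proof.
move=> hF /memv_sumP[vs hvs ->].
under eq_bigr => v _ do rewrite sum_ffunE.
rewrite exchange_big /= big1 // => e eF; have /vlineP[a ->] := hvs e eF.
under eq_bigr => v _ do rewrite ffunE.
rewrite -scaler_sumr.
by rewrite sum_edge_vec; have := hF e eF; rewrite negbK => /eqP->; rewrite subrr scaler0.
Qed.

Lemma grank_rank : rank_function grank.
Proof.
have sub F F' : F \subset F' -> (edge_span F <= edge_span F')%VS.
  move=> sF; apply/subv_sumP=> e eF; apply: sumv_sup (subvv _).
  exact: (subsetP sF).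
have U F F' : (edge_span (F :|: F') <= edge_span F + edge_span F')%VS.
  apply/subv_sumP=> e; rewrite inE => /orP[] eF; rewrite -memvE; apply: (subvP _ _ (edge_vec_span eF)).
    exact: addvSl.
  exact: addvSr.
split.
- by rewrite /grank /edge_span big_set0 dimv0.
- move=> e F; rewrite -addn1 addnC; apply: leq_trans (dimvS (U _ _)) _.
  apply: leq_trans (dimv_add_leqif _ _) _; rewrite leq_add2r /edge_span big_set1 dim_vline.
  by case: (_ != 0).
- by move=> F F' sF; apply/dimvS/sub.
move=> F F'; rewrite /grank -(dimv_sum_cap (edge_span F)); apply: leq_add; apply: dimvS; first exact: U.
by rewrite subv_cap !sub ?subsetIl ?subsetIr.
Qed.

Lemma grank_lt F (v0 : V) : (grank F < n)%N.
Proof.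
rewrite ltn_neqAle dimvS ?subvf // andbT; apply/negP=> /eqP e.
have ef : edge_span F = fullv by apply/eqP; rewrite -(dimv_leqif_eq (subvf _)) -e.
have : delta v0 \in edge_span F by rewrite ef memvf.
move/(@sum_edge_span _ setT)=> h; have := sum_delta setT v0; rewrite h => [|e' _].
  by rewrite inE => /eqP.
by rewrite !inE.
Qed.

(** If no edge of [F] crossed [S], the vector [delta u - delta w] with [u] inside and [w] outside
    would lie off the span and enlarge it to the whole space; but all these vectors have coordinate
    sum zero. *)
Lemma grank_connected F S : (n <= (grank F).+1)%N -> S != set0 -> S != setT ->
  exists2 e, e \in F & crosses e S.
Proof.
move=> hr /set0Pn[u uS] nST.
have [w wS] : exists w, w \notin S.
  by apply/existsP; rewrite -negb_forall; apply: contra nST => /forallP h; apply/eqP/setP=> v; rewrite inE h.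
case: (pickP (fun e => (e \in F) && crosses e S)) => [e /andP[]|no]; first by exists e.
have hF e : e \in F -> ~~ crosses e S by move=> eF; move: (no e); rewrite eF /= => ->.
pose d := delta u - delta w.
have sumd S' : \sum_(v in S') d v = (u \in S')%:R - (w \in S')%:R.
  by rewrite -!sum_delta -sumrB; apply: eq_bigr => v _; rewrite !ffunE.
have nd : d \notin edge_span F.
  apply/negP=> /(sum_edge_span hF); rewrite sumd uS (negPf wS) subr0 => /eqP.
  by rewrite oner_eq0.
have lt : (grank F < \dim (edge_span F + <[d]>))%N.
  rewrite /grank (ltn_leqif (dimv_leqif_sup (addvSl _ _))).
  by apply: contra nd => h; apply: (subvP h); apply: (subvP (addvSr _ _)); apply: memv_line.
have full : (edge_span F + <[d]>)%VS = fullv.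
  by apply/eqP; rewrite -(geq_leqif (dimv_leqif_eq (subvf _))); apply: leq_trans lt.
have : delta u \in (edge_span F + <[d]>)%VS by rewrite full memvf.
case/memv_addP=> x xF [y /vlineP[a ->] e].
have := sum_delta setT u; rewrite e inE.
under eq_bigr => v _ do rewrite ffunE.
rewrite big_split /= (sum_edge_span _ xF) ?add0r => [|e' _]; last by rewrite !inE.
under eq_bigr => v _ do rewrite ffunE.
by rewrite -scaler_sumr sumd !inE subrr scaler0 => /eqP.
Qed.

Lemma adj_sym F : connect_sym (adj s t F).
Proof.
apply: sym_connect_sym => u v; rewrite /adj; apply: eq_existsb => e.
by rewrite orbC.
Qed.

(* The vectors delta v, one v for each component, complete the span to everything. *)
Lemma grank_components F : (n <= grank F + #|[set fingraph.root (adj s t F) v | v in V]|)%N.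
Proof.
set R := [set _ | v in V].
have full : (fullv <= edge_span F + \sum_(v in R) <[delta v]>)%VS.
  apply/subvP=> x _.
  have -> : x = \sum_v x v *: delta v.
    apply/ffunP=> w; rewrite sum_ffunE (bigD1 w) //= big1 => [|v nv].
      by rewrite !ffunE eqxx addr0 /GRing.scale /= mulr1.
    by rewrite !ffunE eq_sym (negPf nv) /GRing.scale /= mulr0.
  apply: rpred_sum => v _; apply: rpredZ.
  have -> : delta v = (delta v - delta (fingraph.root (adj s t F) v)) + delta (fingraph.root (adj s t F) v).
    by rewrite subrK.
  apply: memv_add; last first.
    have rR : fingraph.root (adj s t F) v \in R by apply: imset_f.
    by apply: (subvP (sumv_sup _ rR (subvv _))); apply: memv_line.
  have /connectP[p] := connect_root (adj s t F) v.
  elim: p v => [|w p IH] v /=; first by move=> _ ->; rewrite subrr mem0v.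
  case/andP=> vw pw e.
  have -> : delta v - delta (fingraph.root (adj s t F) v) =
     (delta v - delta w) + (delta w - delta (fingraph.root (adj s t F) v)) by rewrite addrA subrK.
  have er : fingraph.root (adj s t F) v = fingraph.root (adj s t F) w.
    by apply/eqP; rewrite root_connect ?connect1 //; exact: adj_sym.
  apply: memvD; last by rewrite er; apply: IH => //; rewrite -er.
  case/exists_inP: vw => f fF /orP[]/andP[/eqP <- /eqP <-]; first exact: edge_vec_span.
  by rewrite -opprB memvN edge_vec_span.
apply: leq_trans (dimvS full) _.
apply: leq_trans (dimv_add_leqif _ _) _; rewrite leq_add2l.
apply: leq_trans (dimv_leq_sum _ _ _) _.
rewrite -sum1_card; apply: leq_sum => v _; rewrite dim_vline; by case: (_ != 0).
Qed.

(** If [F] has several components, at least [k] edges of [D] leave each, none of them in [F], and an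
    edge leaves at most two components. The number of components is at least [n - grank F]. *)
Lemma grank_cut D F k :
  (forall S, S != set0 -> S != setT -> (k <= #|[set e in D | crosses e S]|)%N) ->
  (n <= (grank F).+1)%N \/ (k * (n - grank F) <= 2 * #|D :\: F|)%N.
Proof.
move=> hD; set q := #|[set fingraph.root (adj s t F) v | v in V]|.
have hq : (n <= grank F + q)%N := grank_components F.
have [le1|gt1] := leqP q 1; first by left; move: hq le1; clear; lia.
right; apply: (@leq_trans (k * q)); first by rewrite leq_mul2l leq_subLR hq orbT.
pose C (v : V) := [set w | fingraph.root (adj s t F) w == v].
pose R := [set fingraph.root (adj s t F) v | v in V].
have crossC v e : crosses e (C v) -> (fingraph.root (adj s t F) (s e) == v) || (fingraph.root (adj s t F) (t e) == v).
  by rewrite !inE; do 2!case: (_ == v).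
have noF v e : crosses e (C v) -> e \notin F.
  apply: contraTN => eF; rewrite !inE negbK.
  suff -> : fingraph.root (adj s t F) (s e) = fingraph.root (adj s t F) (t e) by [].
  apply/eqP; rewrite root_connect; last exact: adj_sym.
  by apply: connect1; apply/exists_inP; exists e; rewrite // !eqxx.
have : (\sum_(v in R) k <= \sum_(v in R) \sum_(e in D) crosses e (C v))%N.
  apply: leq_sum => v /imsetP[w _ ev].
  have := hD (C v); rewrite -sum1_card big_mkcond /=.
  have -> : (\sum_(e in E) (if e \in [set e0 in D | crosses e0 (C v)] then 1 else 0) =
             \sum_(e in D) crosses e (C v))%N.
    rewrite [RHS]big_mkcond; apply: eq_bigr => e _; rewrite inE.
    by case: (e \in D) => //=; case: (_ != _).
  apply.
    by apply/set0Pn; exists w; rewrite inE ev.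
  apply: contraTneq gt1 => eT; rewrite -leqNgt /q.
  suff -> : [set fingraph.root (adj s t F) v0 | v0 in V] = [set v] by rewrite cards1.
  apply/setP=> y; rewrite inE; apply/imsetP/eqP=> [[x _ ->]|->]; last by exists w.
  have : x \in C v by rewrite eT inE.
  by rewrite inE => /eqP.
rewrite sum_nat_const mulnC exchange_big /= => /leq_trans; apply.
rewrite mulnC -sum_nat_const [leqRHS]big_mkcond [leqLHS]big_mkcond /=.
apply: leq_sum => e _; rewrite in_setD.
case: (e \in D); rewrite ?andbF // andbT.
have [eF|eF] := boolP (e \in F).
  by rewrite big1 // => v _; case: (boolP (_ != _)) => // /noF; rewrite eF.
apply: (@leq_trans (\sum_(v in R) ((fingraph.root (adj s t F) (s e) == v) + (fingraph.root (adj s t F) (t e) == v)))).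
  apply: leq_sum => v _; case: (boolP (_ != _)) => // /crossC.
  by case: (_ == v); case: (_ == v).
have one a : (\sum_(v in R) (a == v) <= 1)%N.
  apply: (@leq_trans (\sum_v (a == v))).
    by rewrite big_mkcond; apply: leq_sum => v _; case: (v \in R).
  by rewrite (bigD1 a) //= eqxx big1 // => v; rewrite eq_sym => /negPf->.
by rewrite big_split /= -[2%N]addn1 leq_add.
Qed.

End GraphicRank.

Section PartitionMatroid.
Variables (V E : finType) (kappa : E -> V) (c : V -> nat).

Definition fibre (X : {set E}) v := [set e in X | kappa e == v].
Definition partition_rank (X : {set E}) := \sum_v minn (c v) #|fibre X v|.

Lemma sum_fibre (X : {set E}) : \sum_v #|fibre X v| = #|X|.
Proof.
under eq_bigr => v _ do rewrite -sum1_card big_mkcond.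
rewrite exchange_big /= -sum1_card [RHS]big_mkcond; apply: eq_bigr => e _.
rewrite (bigD1 (kappa e)) //= inE eqxx andbT big1 ?addn0 // => v nv.
by rewrite inE eq_sym (negPf nv) andbF.
Qed.

Lemma partition_rankP : rank_function partition_rank.
Proof.
have fS (X Y : {set E}) v : X \subset Y -> #|fibre X v| <= #|fibre Y v|.
  by move=> sXY; apply/subset_leq_card/subsetP=> e; rewrite !inE => /andP[/(subsetP sXY)-> ->].
split.
- rewrite /partition_rank big1 // => v _; apply/eqP; rewrite -leqn0.
  by apply: leq_trans (geq_minr _ _) _; rewrite leqn0 cards_eq0; apply/eqP/setP=> e; rewrite !inE.
- move=> e X; rewrite /partition_rank (bigD1 (kappa e)) // [X in _ <= X.+1](bigD1 (kappa e)) //=.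
  rewrite -addSn leq_add //.
    have le : #|fibre (e |: X) (kappa e)| <= #|fibre X (kappa e)|.+1.
      apply: (@leq_trans #|e |: fibre X (kappa e)|); last by rewrite cardsU1; case: (_ \notin _).
      by apply/subset_leq_card/subsetP=> x; rewrite !inE => /andP[/orP[->//|-> ->]]; rewrite orbT.
    by move: le; clear; lia.
  apply: leq_sum => v nv; suff -> : fibre (e |: X) v = fibre X v by [].
  by apply/setP=> x; rewrite !inE; case: eqP => //= ->; rewrite eq_sym (negPf nv) !andbF.
- move=> X Y sXY; apply: leq_sum => v _.
  by have := fS X Y v sXY; clear; lia.
move=> X Y; rewrite /partition_rank -!big_split /=; apply: leq_sum => v _.
have := cardsUI (fibre X v) (fibre Y v).
have -> : fibre X v :|: fibre Y v = fibre (X :|: Y) v.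
  by apply/setP=> e; rewrite !inE andb_orl.
have -> : fibre X v :&: fibre Y v = fibre (X :&: Y) v.
  by apply/setP=> e; rewrite !inE; case: (e \in X); case: (e \in Y); case: (_ == v).
move: (fS _ _ v (subsetUl X Y)) (fS _ _ v (subsetUr X Y)).
by clear; lia.
Qed.

End PartitionMatroid.

(** * Edge-disjoint spanning sets with bounded degrees *)

Section Packing.
Variables (V E : finType) (s t : E -> V) (N : nat).
Implicit Types (U : {set E * 'I_N}).

(** This makes the [N] copies of an edge parallel, so that different trees share no edge. *)
Lemma rank_projection (rho : {set E} -> nat) : rank_function rho ->
  rank_function (fun U => rho (fst @: U)).
Proof.
move=> rf; split.
- by rewrite imset0 (rank0 rf).
- by move=> [e i] U; rewrite imsetU1 rankU1.
- by move=> U U' sU; apply/(rankS rf)/imsetS.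
move=> U U'; rewrite imsetU; apply: leq_trans (rankUI rf _ _).
rewrite leq_add2l; apply/(rankS rf); rewrite subsetI.
by rewrite !imsetS ?subsetIl ?subsetIr.
Qed.

Definition slice U i := [set e | (e, i) \in U].

(** The direct sum of [N] copies, one for each tree. *)
Lemma rank_slices (rho : {set E} -> nat) : rank_function rho ->
  rank_function (fun U => \sum_i rho (slice U i)).
Proof.
move=> rf; split.
- rewrite big1 // => i _; rewrite -(rank0 rf); congr rho.
  by apply/setP=> e; rewrite !inE.
- move=> [e j] U; rewrite (bigD1 j) // [X in _ <= X.+1](bigD1 j) //= -addSn leq_add //.
    suff -> : slice ((e, j) |: U) j = e |: slice U j by exact: rankU1.
    by apply/setP=> x; rewrite !inE xpair_eqE eqxx andbT.
  apply: leq_sum => i ni; suff -> : slice ((e, j) |: U) i = slice U i by [].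
  by apply/setP=> x; rewrite !inE xpair_eqE (negPf ni) andbF.
- move=> U U' sU; apply: leq_sum => i _; apply: (rankS rf).
  by apply/subsetP=> e; rewrite !inE => /(subsetP sU).
move=> U U'; rewrite -!big_split /=; apply: leq_sum => i _.
have -> : slice (U :|: U') i = slice U i :|: slice U' i by apply/setP=> e; rewrite !inE.
have -> : slice (U :&: U') i = slice U i :&: slice U' i by apply/setP=> e; rewrite !inE.
exact: rankUI.
Qed.

Notation crosses e S := ((s e \in S) != (t e \in S)).

Definition spanning (F : {set E}) := forall S : {set V}, S != set0 -> S != setT ->
  exists2 e, e \in F & crosses e S.

Lemma tree_packing (v0 : V) (D : {set E}) (kappa : E -> V) (c : V -> nat) a k : 0 < a -> 2 * a * N <= k ->
  (forall S, S != set0 -> S != setT -> k <= #|[set e in D | crosses e S]|) ->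
  (forall v, #|fibre kappa D v| <= a * c v) ->
  exists T : 'I_N -> {set E},
  [/\ forall i, T i \subset D, forall i j e, e \in T i -> e \in T j -> i = j,
      forall i, spanning (T i) & forall v, #|fibre kappa (\bigcup_i T i) v| <= c v].
Proof.
move=> a0 hk hcut hc.
pose n := \dim (fullv : {vspace {ffun V -> rat^o}}).
pose r1 U := \sum_i grank s t (slice U i).
pose r2 U := partition_rank kappa c (fst @: U).
have rf1 : rank_function r1 := rank_slices (grank_rank s t).
have rf2 : rank_function r2 := rank_projection (partition_rankP kappa c).
pose DD : {set E * 'I_N} := [set p | p.1 \in D].
have lt F : grank s t F < n := grank_lt s t F v0.
have [|I [sI cI i1 i2]] := @matroid_intersection _ r1 r2 DD (N * n.-1) rf1 rf2.
  move=> U sU; case: (pickP (fun i => (grank s t (slice U i)).+1 < n)) => [i0 _|no]; last first.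
    apply: (@leq_trans (r1 U)); last exact: leq_addr.
    rewrite /r1 -[X in X * _]card_ord -sum_nat_const; apply: leq_sum => i _.
    by move: (no i) (lt (slice U i)); clear; lia.
  (* The slice of least rank bounds [r1] below by [N] times that rank. Every edge of [D] outside
     this slice has a copy outside [U], so it counts in [r2], up to the factor [a] lost to the
     capacities. *)
  case: (@arg_minnP _ i0 xpredT (fun i => grank s t (slice U i)) isT) => j _ jmin.
  have h1 : N * grank s t (slice U j) <= r1 U.
    rewrite /r1 -[X in X * _]card_ord -sum_nat_const; apply: leq_sum => i _; exact: jmin.
  case: (grank_cut (slice U j) hcut) => [le|hcr].
    apply: leq_trans (leq_addr _ _); apply: leq_trans h1; rewrite leq_mul2l; apply/orP; right.
    by move: le; rewrite -/n; clear; lia.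
  have h2 : #|D :\: slice U j| <= a * r2 (DD :\: U).
    rewrite -(sum_fibre kappa) /r2 /partition_rank big_distrr /=; apply: leq_sum => v _.
    have f1 : #|fibre kappa (D :\: slice U j) v| <= #|fibre kappa D v|.
      by apply/subset_leq_card/subsetP=> e; rewrite !inE => /andP[/andP[_ ->] ->].
    have f2 : #|fibre kappa (D :\: slice U j) v| <= #|fibre kappa (fst @: (DD :\: U)) v|.
      apply/subset_leq_card/subsetP=> e; rewrite !inE => /andP[/andP[nU eD] ->]; rewrite andbT.
      by apply/imsetP; exists (e, j); rewrite // !inE nU.
    rewrite /minn; case: ifP => _; first exact: leq_trans (hc v).
    by apply: leq_trans f2 _; apply: leq_pmull.
  have hq := lt (slice U j).
  have h3 : N * (n - grank s t (slice U j)) <= r2 (DD :\: U).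
    rewrite -(leq_pmul2l (m := 2 * a)) ?muln_gt0 // mulnA.
    by move: hk hcr h2; rewrite -/n; clear; nia.
  by move: h1 h3 hq; clear; nia.
have hr i : grank s t (slice I i) = n.-1.
  have : \sum_i (n.-1 - grank s t (slice I i)) = 0.
    rewrite sumnB; last by move=> j _; move: (lt (slice I j)); clear; lia.
    by rewrite sum_nat_const card_ord -/(r1 I) i1 subnn.
  move/eqP; rewrite sum_nat_eq0 => /forallP/(_ i)/=; move: (lt (slice I i)); clear; lia.
have hP : #|fst @: I| = #|I| /\ forall v, #|fibre kappa (fst @: I) v| <= c v.
  have h1 : #|fst @: I| <= N * n.-1 by rewrite -cI leq_imset_card.
  have h3 : \sum_v (#|fibre kappa (fst @: I) v| - c v) + N * n.-1 = #|fst @: I|.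
    rewrite -[N * n.-1]i2 -(sum_fibre kappa (fst @: I)) /r2 /partition_rank -big_split /=.
    by apply: eq_bigr => v _; clear; lia.
  have h4 : \sum_v (#|fibre kappa (fst @: I) v| - c v) = 0.
    by apply/eqP; rewrite -leqn0 -(leq_add2r (N * n.-1)) h3 add0n.
  split; first by rewrite -h3 h4 cI.
  by move=> v; move/eqP: h4; rewrite sum_nat_eq0 => /forallP/(_ v).
have inj : {in I &, injective (@fst E 'I_N)} by apply/imset_injP/eqP; case: hP.
exists (slice I); split.
- by move=> i; apply/subsetP=> e; rewrite inE => /(subsetP sI); rewrite inE.
- by move=> i j e; rewrite !inE => eI ej; have [] := inj _ _ eI ej erefl.
- move=> i S S0 S1; apply: (@grank_connected _ _ s t _ S _ S0 S1).
  by rewrite hr prednK //; apply: leq_ltn_trans (lt set0).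
move=> v; suff -> : \bigcup_i slice I i = fst @: I by case: hP.
apply/setP=> e; apply/bigcupP/imsetP=> [[i _]|[[x i] xI ->]].
  by rewrite inE => eI; exists (e, i).
by exists i; rewrite ?inE.
Qed.

End Packing.

(** * Splitting a bipartite graph *)

Lemma sum_over_fibres (V E : finType) (kappa : E -> V) (X : {set E}) (y : E -> nat) :
  \sum_v \sum_(e in fibre kappa X v) y e = \sum_(e in X) y e.
Proof.
under eq_bigr => v _ do rewrite big_mkcond.
rewrite exchange_big /= [RHS]big_mkcond; apply: eq_bigr => e _.
rewrite (bigD1 (kappa e)) //= inE eqxx andbT big1 ?addn0 // => v nv.
by rewrite inE eq_sym (negPf nv) andbF.
Qed.

(** [y / D] is a fractional common independent vector of two partition matroids: splitting its total
    weight between [U] and the complement gives the rank condition. Equal totals turn capacities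
    into exact degrees. *)
Lemma bipartite_rounding (V E : finType) (X : {set E}) (y : E -> nat) D
    (kappa1 kappa2 : E -> V) (h1 h2 : V -> nat) : 0 < D ->
  (forall e, e \in X -> y e <= D) ->
  (forall v, \sum_(e in fibre kappa1 X v) y e = D * h1 v) ->
  (forall v, \sum_(e in fibre kappa2 X v) y e = D * h2 v) ->
  exists I : {set E}, [/\ I \subset X, forall v, #|fibre kappa1 I v| = h1 v
    & forall v, #|fibre kappa2 I v| = h2 v].
Proof.
move=> D0 yD s1 s2.
have e1 : \sum_(e in X) y e = D * \sum_v h1 v.
  by rewrite -(sum_over_fibres kappa1) big_distrr; apply: eq_bigr => v _; rewrite s1.
have e2 : \sum_v h2 v = \sum_v h1 v.
  apply/eqP; rewrite -(eqn_pmul2l D0) -e1 -(sum_over_fibres kappa2) big_distrr /=.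
  by apply/eqP/esym/eq_bigr => v _; rewrite s2.
have bound (kappa : E -> V) h (U : {set E}) : (forall v, \sum_(e in fibre kappa X v) y e = D * h v) ->
    U \subset X -> \sum_(e in U) y e <= D * partition_rank kappa h U.
  move=> sh sU; rewrite -(sum_over_fibres kappa) /partition_rank big_distrr; apply: leq_sum => v _ /=.
  have le1 : \sum_(e in fibre kappa U v) y e <= D * h v.
    rewrite -sh [leqLHS]big_mkcond [leqRHS]big_mkcond; apply: leq_sum => e _.
    rewrite !inE; have [eU|//] := boolP (e \in U).
    by rewrite (subsetP sU _ eU).
  have le2 : \sum_(e in fibre kappa U v) y e <= D * #|fibre kappa U v|.
    rewrite mulnC -sum_nat_const; apply: leq_sum => e; rewrite inE => /andP[eU _].
    exact/yD/(subsetP sU).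
  by rewrite /minn; case: ifP.
have [|I [sI cI i1 i2]] := matroid_intersection (D := X) (k := \sum_v h1 v)
    (partition_rankP kappa1 h1) (partition_rankP kappa2 h2).
  move=> U sU; rewrite -(leq_pmul2l D0) -e1 mulnDr (big_setID U) /= (setIidPr sU).
  by rewrite leq_add // bound // subsetDl.
have exact_fibre (kappa : E -> V) h : \sum_v h v = \sum_v h1 v -> partition_rank kappa h I = \sum_v h1 v ->
    forall v, #|fibre kappa I v| = h v.
  move=> eh ei v.
  have a1 : \sum_w (h w - #|fibre kappa I w|) = 0.
    have : \sum_w (h w - #|fibre kappa I w|) + partition_rank kappa h I = \sum_w h w.
      by rewrite /partition_rank -big_split /=; apply: eq_bigr => w _; clear; lia.
    by rewrite ei eh; clear; lia.
  have a2 : \sum_w (#|fibre kappa I w| - h w) = 0.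
    have : \sum_w (#|fibre kappa I w| - h w) + partition_rank kappa h I = #|I|.
      by rewrite -(sum_fibre kappa) /partition_rank -big_split /=; apply: eq_bigr => w _; clear; lia.
    by rewrite ei cI; clear; lia.
  move/eqP: a1; move/eqP: a2; rewrite !sum_nat_eq0 => /forallP/(_ v)/= b1 /forallP/(_ v)/= b2.
  by move: b1 b2; clear; lia.
by exists I; split=> //; apply: exact_fibre.
Qed.

Lemma bounded_weights (E : finType) (X : {set E}) D T : 1 < D -> #|X| <= T <= #|X| * D.-1 ->
  exists x : E -> nat, (forall e, 0 < x e < D) /\ \sum_(e in X) x e = T.
Proof.
move=> D1 /andP[hl hu].
have [X0|X0] := posnP #|X|.
  exists (fun=> 1); split=> [e|]; first by rewrite D1.
  by rewrite sum_nat_const X0 mul0n; move: hu; rewrite X0 mul0n leqn0 => /eqP.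
have [B sB cB] := @exists_subset_card _ X (T %% #|X|) (ltnW (ltn_pmod _ X0)).
have eT := divn_eq T #|X|.
exists (fun e => T %/ #|X| + (e \in B)); split.
  move=> e; have q1 : 0 < T %/ #|X| by rewrite divn_gt0.
  rewrite addn_gt0 q1 /=.
  have [eB|_] := boolP (e \in B).
    have r0 : 0 < T %% #|X| by rewrite -cB card_gt0; apply/set0Pn; exists e.
    have : T %/ #|X| * #|X| < #|X| * D.-1 by move: hu r0 eT; clear; lia.
    by rewrite mulnC ltn_pmul2l //; move: D1; clear; lia.
  have : T %/ #|X| * #|X| <= #|X| * D.-1 by move: hu eT; clear; lia.
  by rewrite mulnC leq_pmul2l //; move: D1; clear; lia.
rewrite big_split /= sum_nat_const mulnC [RHS]eT -cB -[#|B|]sum1_card; congr (_ + _).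
rewrite big_mkcond [RHS]big_mkcond; apply: eq_bigr => e _.
have [eB|_] := boolP (e \in B); last by case: ifP.
by rewrite (subsetP sB).
Qed.

(** The last clause says, without mentioning orbits, that [pi] is transitive on each class of
    [key]. *)
Lemma cyclic_shift (E : finType) (K : eqType) (key : E -> K) :
  exists pi rho : E -> E, [/\ cancel pi rho, cancel rho pi, forall e, key (pi e) = key e &
    forall P : pred E, (forall e, P e -> P (pi e)) -> forall e e', key e = key e' -> P e -> P e'].
Proof.
pose cls k := enum [pred x | key x == k].
have ucls k : uniq (cls k) := enum_uniq _.
have in_cls k e : (e \in cls k) = (key e == k) by rewrite mem_enum.
pose pi e := next (cls (key e)) e; pose rho e := prev (cls (key e)) e.
have kpi e : key (pi e) = key e by apply/eqP; rewrite -in_cls mem_next in_cls.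
have krho e : key (rho e) = key e by apply/eqP; rewrite -in_cls mem_prev in_cls.
exists pi, rho; split=> //.
- by move=> e; rewrite /rho kpi /pi prev_next.
- by move=> e; rewrite /pi krho /rho next_prev.
move=> P hP e e' ke Pe.
have fc : fcycle (next (cls (key e))) (cls (key e)) by apply: cycle_next.
have con : fconnect (next (cls (key e))) e e'.
  by rewrite (fconnect_cycle fc) in_cls // ke.
rewrite -(iter_findex con).
have [] // : P (iter (findex (next (cls (key e))) e e') (next (cls (key e))) e) /\
    key (iter (findex (next (cls (key e))) e e') (next (cls (key e))) e) = key e.
elim: (findex _ _ _) => //= n [Pn kn].
move: (iter _ _ _) Pn kn => y Py ky.
have -> : next (cls (key e)) y = pi y by rewrite /pi ky.
by split; [exact: hP | rewrite kpi].
Qed.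

Lemma card_le_transversal (E : finType) N (T : 'I_N -> {set E}) (J : {set 'I_N}) (X : {set E}) :
  (forall i j e, e \in T i -> e \in T j -> i = j) ->
  (forall i, i \in J -> exists2 e, e \in T i & e \in X) -> #|J| <= #|X|.
Proof.
move=> dis meet; pose f i := [pick e in T i | e \in X].
have fP i : i \in J -> exists e, [/\ f i = Some e, e \in T i & e \in X].
  move=> /meet[e eT eX]; rewrite /f; case: pickP => [y /andP[yT yX]|/(_ e)]; first by exists y.
  by rewrite eT eX.
have inj : {in J &, injective f}.
  move=> a b /fP[x [-> xa _]] /fP[y [-> yb _]] [exy].
  by apply: dis xa _; rewrite exy.
rewrite -(card_in_imset inj) -(card_imset X (f := Some)); last by move=> x y [].
apply/subset_leq_card/subsetP=> o /imsetP[i /fP[e [-> _ eX]] ->].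
exact: imset_f.
Qed.

Section EdgeConn.
Variables (V E : finType) (s t : E -> V).
Notation crosses e S := ((s e \in S) != (t e \in S)).

Lemma edge_conn_le k k' (F : {set E}) : k <= k' -> edge_conn s t k' F -> edge_conn s t k F.
Proof. by move=> le h D sD hD; apply: h => //; apply: leq_trans le. Qed.

Lemma edge_conn_cut k (F : {set E}) (S : {set V}) : edge_conn s t k F -> S != set0 -> S != setT ->
  k <= #|[set e in F | crosses e S]|.
Proof.
move=> h /set0Pn[u uS] nST; rewrite leqNgt; apply/negP=> lt.
have [w wS] : exists w, w \notin S.
  apply/existsP; rewrite -negb_forall; apply: contra nST => /forallP hh.
  by apply/eqP/setP=> v; rewrite inE hh.
set D := [set e in F | _] in lt.
have sD : D \subset F by apply/subsetP=> e; rewrite inE => /andP[].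
have cl : closed (adj s t (F :\: D)) (mem S).
  move=> a b /exists_inP[e]; rewrite !inE => /andP[nD eF].
  rewrite eF /= negbK in nD; move/eqP: nD => eD.
  by case/orP=> /andP[/eqP <- /eqP <-].
by have := closed_connect cl (h D sD lt u w); rewrite /= uS (negPf wS).
Qed.

Lemma spanning_connected (F : {set E}) : spanning s t F -> connectedG s t F.
Proof.
move=> sp u w; pose S := [set v | connect (adj s t F) u v].
have [eS|nS] := eqVneq S setT.
  have : w \in S by rewrite eS inE.
  by rewrite inE.
have S0 : S != set0 by apply/set0Pn; exists u; rewrite inE connect0.
have [e eF] := sp S S0 nS.
have a1 : adj s t F (s e) (t e) by apply/exists_inP; exists e; rewrite // !eqxx.
have a2 : adj s t F (t e) (s e) by apply/exists_inP; exists e; rewrite // !eqxx orbT.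
rewrite !inE; case: (boolP (connect _ u (s e))) => h1; case: (boolP (connect _ u (t e))) => h2 // _.
  by rewrite (connect_trans h1 (connect1 a1)) in h2.
by rewrite (connect_trans h2 (connect1 a2)) in h1.
Qed.

Lemma edge_conn_packing N (T : 'I_N -> {set E}) (J : {set 'I_N}) (F : {set E}) :
  (forall i j e, e \in T i -> e \in T j -> i = j) -> (forall i, i \in J -> spanning s t (T i)) ->
  (forall i, i \in J -> T i \subset F) -> edge_conn s t #|J| F.
Proof.
move=> dis sp sF D sD hD.
have [i iJ iD] : exists2 i, i \in J & [disjoint T i & D].
  case: (pickP (fun i => (i \in J) && [disjoint T i & D])) => [i /andP[]|no]; first by exists i.
  suff : #|J| <= #|D| by rewrite leqNgt hD.
  apply: card_le_transversal dis _ => i iJ; move: (no i); rewrite iJ /= => /negbT/pred0Pn[e /andP[]]; by exists e.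
apply: spanning_connected => S S0 S1; have [e eT ec] := sp i iJ S S0 S1; exists e => //.
by rewrite inE (subsetP (sF i iJ) _ eT) andbT; apply/negP=> eD; have /pred0P/(_ e) := iD; rewrite /= eT eD.
Qed.

End EdgeConn.

(** * The auxiliary graph on the vertices outside [A] *)

Section VirtualGraph.
Variables (V E : finType) (s t : E -> V) (A : {set V}).
Hypothesis bip : bipartite_on s t A.
Notation crosses e S := ((s e \in S) != (t e \in S)).

Definition aend e := if s e \in A then s e else t e.
Definition bend e := if s e \in A then t e else s e.

Lemma aend_in e : aend e \in A.
Proof. by rewrite /aend; have := bip e; case sA: (s e \in A) => //=; case: (t e \in A). Qed.

Lemma bend_out e : bend e \notin A.
Proof. by rewrite /bend; have := bip e; case sA: (s e \in A) => /=; [case: (t e \in A) | rewrite sA]. Qed.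

Lemma crosses_ends e (S : {set V}) : crosses e S = ((aend e \in S) != (bend e \in S)).
Proof. by rewrite /aend /bend; case: ifP => // _; rewrite eq_sym. Qed.

Lemma deg_aend F v : v \in A -> deg s t F v = #|fibre aend F v|.
Proof.
move=> vA; apply: eq_card => e; rewrite !inE /incident /aend; congr (_ && _).
have := bip e; case: ifP => sA tA.
  by rewrite [t e == v](negPf _) ?orbF //; apply: contraNneq tA => ->; rewrite vA.
by rewrite [s e == v](negPf _) //; apply: contraFneq sA => ->.
Qed.

Lemma deg_bend F v : v \notin A -> deg s t F v = #|fibre bend F v|.
Proof.
move=> vA; apply: eq_card => e; rewrite !inE /incident /bend; congr (_ && _).
have := bip e; case: ifP => sA tA.
  by rewrite [s e == v](negPf _) //; apply: contraNneq vA => <-.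
by rewrite [t e == v](negPf _) ?orbF //; apply: contraNneq vA => <-; move: tA; case: (t e \in A).
Qed.

(* [pi] rotates the edges of a tree T i around their common end in A.  An edge e with
   psi e = 1 sends one unit along e and takes one from pi e, so the vertex in A is
   balanced. *)
Lemma exact_flow K k : orients_modulo K k ->
  forall N (T : 'I_N -> {set E}) (J : {set 'I_N}),
  (forall i j e, e \in T i -> e \in T j -> i = j) -> (forall i, i \in J -> spanning s t (T i)) ->
  k <= #|J| ->
  forall r : V -> int, (K%:Z %| (\sum_(v in ~: A) r v)%R)%Z ->
  exists phi : E -> int, [/\ forall e, (`|phi e| <= 1)%R,
    forall e, e \notin \bigcup_(i in J) T i -> phi e = 0,
    forall v, (\sum_(e | aend e == v) phi e = 0)%R &
    forall v, v \notin A -> (K%:Z %| (\sum_(e | bend e == v) phi e - r v)%R)%Z].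
Proof.
move=> orient N T J dis sp kJ r hr.
pose idx e := [pick i in J | e \in T i].
have idxT i e : i \in J -> e \in T i -> idx e = Some i.
  rewrite /idx => iJ eT; case: pickP => [j /andP[_ ej]|/(_ i)]; first by rewrite (dis _ _ _ eT ej).
  by rewrite iJ eT.
have idxS i e : idx e = Some i -> i \in J /\ e \in T i.
  by rewrite /idx; case: pickP => // j /andP[jJ ej] [<-].
(* Edges outside the trees of [J] get private keys: [pi] fixes them, they become loops, and their
   correction vanishes. *)
pose key e : V * 'I_N + E := if idx e is Some i then inl (aend e, i) else inr e.
have [pi [rho [pK rK kpi clo]]] := cyclic_shift key.
have api e : aend (pi e) = aend e.
  have := kpi e; rewrite /key; case: (idx e) => [i|]; case: (idx (pi e)) => [j|] //.
    by case.
  by case=> ->.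
have ipi e i : idx e = Some i -> idx (pi e) = Some i.
  by move=> ie; have := kpi e; rewrite /key ie; case: (idx (pi e)) => [j|] // [_ ->].
have npi e : idx e = None -> pi e = e.
  by move=> ie; have := kpi e; rewrite /key ie; case: (idx (pi e)) => [j|] // [->].
have [||psi hpsi] := orient V E bend (fun e => bend (pi e)) (~: A) _ _ r hr.
- by move=> e; rewrite !inE !bend_out.
- move=> S sS S0 S1.
  apply: leq_trans kJ _; apply: card_le_transversal dis _ => i iJ.
  case: (pickP (fun e => (e \in T i) && ((bend e \in S) != (bend (pi e) \in S)))) => [e /andP[eT eS]|no].
    by exists e; rewrite ?inE.
  have stay e : e \in T i -> (bend (pi e) \in S) = (bend e \in S).
    by move=> eT; move: (no e); rewrite eT /= => /negbFE/eqP.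
  (* If the rotation never crosses [S], the edges of [T i] at a vertex of [A] agree about [S].
     Adding to [S] the vertices of [A] on its side gives a set that [T i] does not cross. *)
  pose S' := S :|: [set v in A | [exists e in T i, (aend e == v) && (bend e \in S)]].
  have bS' e : (bend e \in S') = (bend e \in S) by rewrite !inE (negPf (bend_out e)) orbF.
  have S'0 : S' != set0 by have /set0Pn[v vS] := S0; apply/set0Pn; exists v; rewrite inE vS.
  have S'1 : S' != setT.
    apply: contra S1 => /eqP e1; rewrite eqEsubset sS /=; apply/subsetP=> v; rewrite inE => vA.
    by have : v \in S' by [rewrite e1 inE]; rewrite !inE (negPf vA) orbF.
  have [e eT] := sp i iJ S' S'0 S'1.
  rewrite crosses_ends bS'.
  have [bS|bS] := boolP (bend e \in S).
    suff -> : aend e \in S' by [].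
    by rewrite !inE aend_in /=; apply/orP; right; apply/exists_inP; exists e; rewrite // eqxx.
  rewrite /S' !inE aend_in /=.
  have -> : aend e \in S = false.
    by apply/negbTE/negP=> /(subsetP sS); rewrite inE aend_in.
  case: exists_inP => // -[e' e'T /andP[/eqP ea eb]] _.
  have : (e \in T i) && (bend e \in S).
    apply: (clo (fun x => (x \in T i) && (bend x \in S)) _ e' e); last by rewrite e'T.
    - move=> x /andP[xT xS]; rewrite stay // xS andbT.
      by have /idxS[] := ipi _ _ (idxT _ _ iJ xT).
    - by rewrite /key !(idxT i) // ea.
  by rewrite (negPf bS) andbF.
pose phi e : int := ((psi e)%:Z - (psi (rho e))%:Z)%R.
have arho e : aend (rho e) = aend e by rewrite -{2}(rK e) api.
have reindex_pi (P : pred E) : (\sum_(e | P (pi e)) (psi e)%:Z = \sum_(e | P e) (psi (rho e))%:Z)%R.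
  by rewrite [RHS](reindex pi) /=; [apply: eq_bigr => e _; rewrite pK | exists rho => x _].
exists phi; split.
- by move=> e; rewrite /phi; case: (psi e); case: (psi _).
- move=> e eJ; have ie : idx e = None.
    case ei : (idx e) => [i|] //; have [iJ eT] := idxS _ _ ei.
    by case/negP: eJ; apply/bigcupP; exists i.
  by rewrite /phi -{2}(npi e ie) pK subrr.
- move=> v; rewrite sumrB -(reindex_pi (fun e => aend e == v)).
  by rewrite [X in (_ - X)%R](eq_bigl (fun e => aend e == v)) ?subrr // => e; rewrite api.
move=> v vA; have := hpsi v; rewrite inE => /(_ vA).
by rewrite (reindex_pi (fun e => bend e == v)) -sumrB.
Qed.

End VirtualGraph.

Lemma sum_Posz (I : finType) (P : pred I) (F : I -> nat) :
  (\sum_(i | P i) Posz (F i))%R = Posz (\sum_(i | P i) F i).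
Proof. by rewrite (big_morph Posz PoszD (erefl : Posz 0 = 0)). Qed.

Section Fibres.
Variables (V E : finType) (kappa : E -> V).

Lemma fibreU (X Y : {set E}) v : [disjoint X & Y] ->
  #|fibre kappa (X :|: Y) v| = #|fibre kappa X v| + #|fibre kappa Y v|.
Proof.
move=> dXY; have -> : fibre kappa (X :|: Y) v = fibre kappa X v :|: fibre kappa Y v.
  by apply/setP=> e; rewrite !inE andb_orl.
rewrite cardsU; have -> : fibre kappa X v :&: fibre kappa Y v = set0.
  apply/setP=> e; rewrite !inE; have /pred0P/(_ e)/= := dXY.
  by case: (e \in X); case: (e \in Y); rewrite ?andbF.
by rewrite cards0 subn0.
Qed.

Lemma fibreS (X Y : {set E}) v : X \subset Y -> #|fibre kappa X v| <= #|fibre kappa Y v|.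
Proof. by move=> sXY; apply/subset_leq_card/subsetP=> e; rewrite !inE => /andP[/(subsetP sXY)-> ->]. Qed.

Lemma fibreD (X Y : {set E}) v : X \subset Y ->
  #|fibre kappa (Y :\: X) v| + #|fibre kappa X v| = #|fibre kappa Y v|.
Proof.
move=> sXY; rewrite -fibreU; last first.
  by rewrite -setI_eq0; apply/eqP/setP=> e; rewrite !inE; case: (e \in X); rewrite ?andbF.
by rewrite setUC -{1}(setIidPr sXY) setID.
Qed.

End Fibres.

(** Here [a] and [b] are the tree edges given to either side at a vertex. The remaining targets
    [m1 * j - a] and [m2 * j - b] are each at least [j] / 2, so either is at least a 1 / (2m) share
    of the remaining edges; hence the denominator 2m. *)
Lemma weight_bounds m m1 m2 j a b : m = m1 + m2 -> 0 < m1 -> 0 < m2 -> 4 * (a + b) <= j ->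
  m * j - a - b <= 2 * m * (m1 * j - a) <= (m * j - a - b) * (2 * m).-1.
Proof.
move=> em m1P m2P hj.
have h1 : j <= m1 * j by rewrite leq_pmull.
have h2 : j <= m2 * j by rewrite leq_pmull.
have e1 : m * j = m1 * j + m2 * j by rewrite em mulnDl.
have m2' : 2 <= m by rewrite em; lia.
have [u eu] : exists u, m1 * j = u + a by exists (m1 * j - a); lia.
have [w ew] : exists w, m2 * j = w + b by exists (m2 * j - b); lia.
have eN : m * j - a - b = u + w by rewrite e1 eu ew; lia.
have le : u + w <= m * j by rewrite e1 eu ew; lia.
have ju : m * j <= m * (2 * u) by rewrite leq_mul2l; apply/orP; right; lia.
have jw : m * j <= m * (2 * w) by rewrite leq_mul2l; apply/orP; right; lia.
rewrite eN eu addnK; apply/andP; split.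
  by apply: leq_trans le _; apply: leq_trans ju _; rewrite mulnA [m * 2]mulnC.
rewrite -(leq_add2r (u + w)) -mulnSr prednK; last by lia.
have : u + w <= 2 * m * w by apply: leq_trans le _; apply: leq_trans jw _; rewrite mulnA [m * 2]mulnC.
by rewrite [(u + w) * _]mulnC mulnDr leq_add2l.
Qed.

(** * Cutting the graph into two parts *)

Definition splits (m1 m2 lambda f : nat) : Prop :=
  forall (V E : finType) (s t : E -> V) (A : {set V}) (F : {set E}),
    bipartite_on s t A -> edge_conn s t f F ->
    (forall v, v \in A -> m1 + m2 %| deg s t F v) ->
  exists H : {set E}, [/\ H \subset F, edge_conn s t lambda H, edge_conn s t lambda (F :\: H),
    forall v, v \in A -> deg s t H v * (m1 + m2) = m1 * deg s t F v &
    forall v, v \notin A -> m1 %| deg s t H v].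

Lemma bipartite_split m1 m2 lambda : 0 < m1 -> 0 < m2 -> exists f, splits m1 m2 lambda f.
Proof.
move=> m1P m2P; set m := m1 + m2; pose D := 2 * m; pose K := D * m1.
have mP : 1 < m by rewrite /m; lia.
have DP : 1 < D by rewrite /D; lia.
have KP : 0 < K by rewrite muln_gt0; apply/andP; split=> //; lia.
have [k hk] := modular_orientation KP.
(* [lambda] trees for each part and [k] for the auxiliary graph. In [f] the first term is the
   packing bound with [a] = 8m; the second gives [j v] at least 4 on [A], so that rounding down [j]
   / 4 still leaves [j] / 8. *)
pose N := lambda + (lambda + k); pose f := 2 * (8 * m) * N + 4 * m.
exists f => V E s t A F bip Fconn Adiv.
have [V1|V1] := leqP #|V| 1.
  have noE : E -> False.
    move=> e; have := bip e; suff -> : s e = t e by rewrite eqxx.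
    by have /fintype_le1P/(_ (s e) (t e)) := V1.
  have deg0 X v : deg s t X v = 0.
    by apply/eqP; rewrite cards_eq0; apply/eqP/setP=> e; case: (noE e).
  have conn X : edge_conn s t lambda X.
    by move=> Y _ _ u w; have /fintype_le1P/(_ u w)-> := V1; exact: connect0.
  by exists set0; split=> [||| v _| v _]; rewrite ?sub0set ?deg0 ?mul0n ?muln0 ?dvdn0.
have /card_gt0P[v0 _] : 0 < #|V| by apply: ltn_trans V1.
have cuts (S : {set V}) : S != set0 -> S != setT ->
    f <= #|[set e in F | (s e \in S) != (t e \in S)]| by exact: edge_conn_cut.
pose ae := aend s t A; pose be := bend s t A.
have aeA e : ae e \in A := aend_in bip e.
have beA e : be e \notin A := bend_out bip e.
have fibA0 (X : {set E}) v : v \notin A -> fibre ae X v = set0.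
  move=> vA; apply/setP=> e; rewrite !inE; apply/negbTE; rewrite negb_and; apply/orP; right.
  by apply: contraNneq vA => <-.
have fibB0 (X : {set E}) v : v \in A -> fibre be X v = set0.
  move=> vA; apply/setP=> e; rewrite !inE; apply/negbTE; rewrite negb_and; apply/orP; right.
  by apply: contraTneq vA => <-.
pose j v := #|fibre ae F v| %/ m.
have dj v : #|fibre ae F v| = m * j v.
  rewrite mulnC divnK //; have [vA|vA] := boolP (v \in A); last by rewrite fibA0 // cards0 dvdn0.
  by rewrite -(deg_aend bip) // Adiv.
have j4 v : v \in A -> 4 <= j v.
  move=> vA; rewrite -(leq_pmul2l (m := m)); last by apply: ltn_trans mP.
  rewrite -dj; apply: (@leq_trans f); first by rewrite /f mulnC leq_addl.
  apply: leq_trans (cuts [set v] _ _) _.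
  - by apply/set0Pn; exists v; rewrite inE.
  - by apply: contraTneq V1 => e; rewrite -cardsT -e cards1.
  apply/subset_leq_card/subsetP=> e; rewrite inE (crosses_ends s t A) !inE => /andP[-> h].
  have nb : (bend s t A e == v) = false by apply: contraNF (beA e) => /eqP eb; rewrite /be eb.
  by rewrite nb in h; move: h; rewrite -/ae; case: (ae e == v).
(* A quarter of deg / m leaves the target share of the remaining edges strictly
   between 0 and 1, by a margin of 1 / D. *)
pose c v := j v %/ 4.
have hc v : #|fibre ae F v| <= 8 * m * c v.
  have [vA|vA] := boolP (v \in A); last by rewrite fibA0 // cards0.
  rewrite dj [8 * m]mulnC -mulnA leq_mul2l; apply/orP; right; rewrite /c.
  by move: (j4 v vA); clear; lia.
have [||T [sT dis sp cT]] := tree_packing (N := N) (k := f) (a := 8 * m) v0 _ _ cuts hc.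
- by rewrite muln_gt0 /=; apply: ltn_trans mP.
- by rewrite /f leq_addr.
have [J0 _ cJ0] : exists2 J : {set 'I_N}, J \subset setT & #|J| = lambda.
  by apply: exists_subset_card; rewrite cardsT card_ord /N leq_addr.
have cJ0' : #|~: J0| = lambda + k by have := cardsC J0; rewrite card_ord cJ0 /N; clear; lia.
have [J1 sJ1 cJ1] : exists2 J : {set 'I_N}, J \subset ~: J0 & #|J| = lambda.
  by apply: exists_subset_card; rewrite cJ0' leq_addr.
pose J2 := (~: J0) :\: J1.
have cJ2 : k <= #|J2| by rewrite cardsDS // cJ0' cJ1 addKn.
pose H0 := \bigcup_(i in J0) T i; pose H1 := \bigcup_(i in J1) T i.
pose G := F :\: (H0 :|: H1).
have sub_big (J : {set 'I_N}) : \bigcup_(i in J) T i \subset F by apply/bigcupsP.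
have dH : [disjoint H0 & H1].
  apply/pred0P=> e /=; apply/negbTE/negP=> /andP[/bigcupP[i iJ ei] /bigcupP[i' iJ' ei']].
  by move: (subsetP sJ1 _ iJ'); rewrite inE -(dis _ _ _ ei ei') iJ.
have sH : H0 :|: H1 \subset F by rewrite subUset !sub_big.
have t4 v : 4 * (#|fibre ae H0 v| + #|fibre ae H1 v|) <= j v.
  rewrite -fibreU //; have : #|fibre ae (H0 :|: H1) v| <= c v.
    apply: leq_trans (cT v); apply: fibreS.
    by rewrite subUset; apply/andP; split; apply/bigcupsP=> i _; apply: bigcup_sup.
  by rewrite /c; clear; lia.
have cG v : #|fibre ae G v| = m * j v - #|fibre ae H0 v| - #|fibre ae H1 v|.
  by rewrite -dj -(fibreD ae v sH) fibreU // -subnDA addnK.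
have /fin_all_exists[xx hxx] v : exists x : E -> nat, (forall e, 0 < x e < D) /\
    \sum_(e in fibre ae G v) x e = D * (m1 * j v - #|fibre ae H0 v|).
  by apply: bounded_weights => //; rewrite cG; apply: weight_bounds.
pose x e := xx (ae e) e.
have xb e : 0 < x e < D by case: (hxx (ae e)) => h _; exact: h.
have xs v : \sum_(e in fibre ae G v) x e = D * (m1 * j v - #|fibre ae H0 v|).
  case: (hxx v) => _ <-; apply: eq_bigr => e; rewrite inE => /andP[_ /eqP ev].
  by rewrite /x ev.
(* [D] times the fractional degree of [H] at [b], tree edges included; the correction has to cancel
   it modulo [K]. *)
pose r b := \sum_(e in fibre be G b) x e + D * #|fibre be H0 b|.
have t0j v : #|fibre ae H0 v| <= m1 * j v.
  by apply: (@leq_trans (j v)); [move: (t4 v); clear; lia | rewrite leq_pmull].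
have rsum : \sum_(b in ~: A) r b = K * \sum_v j v.
  have -> : \sum_(b in ~: A) r b = \sum_b r b.
    rewrite big_mkcond; apply: eq_bigr => b _; rewrite inE; case: (boolP (b \in A)) => //= bA.
    by rewrite /r !fibB0 // big_set0 cards0 muln0.
  rewrite /r big_split /= -big_distrr /= (sum_over_fibres be) sum_fibre -(sum_over_fibres ae).
  rewrite -(sum_fibre ae H0) !big_distrr -big_split /=; apply: eq_bigr => v _.
  by rewrite xs -mulnDr subnK // mulnA.
have rdiv : (Posz K %| (\sum_(b in ~: A) - Posz (r b))%R)%Z.
  by rewrite sumrN sum_Posz rsum dvdzE abszN absz_nat dvdn_mulr.
have [|phi [phi1 phi0 phiA phiB]] := exact_flow bip hk dis _ cJ2 rdiv.
  by move=> i _; exact: sp.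
have phiG (kappa : E -> V) v : (\sum_(e in fibre kappa G v) phi e = \sum_(e | kappa e == v) phi e)%R.
  rewrite big_mkcond [RHS]big_mkcond; apply: eq_bigr => e _; rewrite inE.
  case: (boolP (e \in G)) => //= eG; rewrite phi0 ?if_same //.
  apply: contra eG => /bigcupP[i iJ ei]; rewrite !inE (subsetP (sT i) _ ei) andbT negb_or.
  move: iJ; rewrite !inE => /andP[i1 i0]; apply/andP; split; apply/bigcupP=> -[i' i'J ei'].
    by rewrite (dis _ _ _ ei ei') i'J in i0.
  by rewrite (dis _ _ _ ei ei') i'J in i1.
pose y e := absz (Posz (x e) + phi e)%R.
have yE e : Posz (y e) = (Posz (x e) + phi e)%R.
  by rewrite /y; move: (xb e) (phi1 e); clear; lia.
have yD e : y e <= D by move: (yE e) (xb e) (phi1 e); clear; lia.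
have ysum (kappa : E -> V) v : Posz (\sum_(e in fibre kappa G v) y e) =
    (Posz (\sum_(e in fibre kappa G v) x e) + \sum_(e | kappa e == v) phi e)%R.
  by rewrite -phiG -!sum_Posz -big_split /=; apply: eq_bigr => e _; rewrite yE.
have yA v : \sum_(e in fibre ae G v) y e = D * (m1 * j v - #|fibre ae H0 v|).
  by apply/eqP; rewrite -eqz_nat ysum phiA addr0 xs.
have yB b : b \notin A -> K %| \sum_(e in fibre be G b) y e + D * #|fibre be H0 b|.
  move=> bA; have := phiB b bA.
  have -> : (\sum_(e | bend s t A e == b) phi e - - Posz (r b))%R =
      Posz (\sum_(e in fibre be G b) y e + D * #|fibre be H0 b|).
    by rewrite PoszD ysum /r PoszD opprK; ring.
  by [].
(* Being 0 modulo [K] up to a multiple of [D], the corrected sums off [A] are multiples of [D], as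
   the rounding demands. *)
have yBD b : \sum_(e in fibre be G b) y e = D * ((\sum_(e in fibre be G b) y e) %/ D).
  have [bA|bA] := boolP (b \in A); first by rewrite fibB0 // big_set0 div0n muln0.
  rewrite mulnC divnK // -(dvdn_addl _ (dvdn_mulr #|fibre be H0 b| (dvdnn D))).
  by apply: dvdn_trans (yB b bA); rewrite /K dvdn_mulr.
have [|I [sI IA IB]] := bipartite_rounding (ltnW DP) _ yA yBD; first by [].
have dI : [disjoint H0 & I].
  apply/pred0P=> e /=; apply/negbTE/negP=> /andP[e0 /(subsetP sI)].
  by rewrite !inE e0.
exists (H0 :|: I); split.
- by rewrite subUset sub_big (subset_trans sI) // subsetDl.
- rewrite -cJ0; apply: edge_conn_packing dis _ _ => i iJ; first exact: sp.
  by apply: subset_trans (subsetUl _ _); apply: bigcup_sup.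
- rewrite -cJ1; apply: edge_conn_packing dis _ _ => i iJ; first exact: sp.
  apply/subsetP=> e ei; have e1 : e \in H1 by apply/bigcupP; exists i.
  rewrite !inE (subsetP (sT i) _ ei) andbT negb_or; apply/andP; split.
    by apply/negP=> e0; have /pred0P/(_ e) := dH; rewrite /= e0 e1.
  by apply/negP=> /(subsetP sI); rewrite !inE e1 orbT.
- move=> v vA; rewrite !(deg_aend bip) // -/ae fibreU // IA subnKC // dj; clear; nia.
move=> b bA; rewrite (deg_bend bip) // -/be fibreU // IB.
rewrite -(dvdn_pmul2l (ltnW DP)) mulnDr -yBD addnC; exact: yB.
Qed.

(** * All colours, by induction on [m] *)

Definition decomposes (m lambda f : nat) : Prop :=
  forall (b : nat) (ms : 'I_b.+1 -> nat),
    (forall i, 0 < ms i) -> m = \sum_(i < b.+1) ms i ->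
  forall (V E : finType) (s t : E -> V) (A : {set V}) (F : {set E}),
    bipartite_on s t A ->
    edge_conn s t f F ->
    (forall v, v \in A -> m %| deg s t F v) ->
  exists c : E -> 'I_b.+1,
    (forall i, edge_conn s t lambda [set e in F | c e == i]) /\
    (forall i v, v \in A -> deg s t [set e in F | c e == i] v * m = ms i * deg s t F v) /\
    (forall (i : 'I_b.+1) v, v \notin A -> i < b -> ms i %| deg s t [set e in F | c e == i] v).

(** The bound is chosen before the parts are known, so it must serve every possible first part and
    every remainder below [m]. *)
Lemma uniform_bound (P : nat -> nat -> Prop) n :
  (forall i f f', f <= f' -> P i f -> P i f') -> (forall i, i < n -> exists f, P i f) ->
  exists f, forall i, i < n -> P i f.
Proof.
move=> mono; elim: n => [|n IH] ex; first by exists 0.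
have [i lt|f hf] := IH; first exact/ex/ltnW.
have [f' hf'] := ex n (ltnSn n).
exists (maxn f f') => i; rewrite ltnS leq_eqVlt => /orP[/eqP->|lt].
  exact: mono (leq_maxr _ _) hf'.
exact: mono (leq_maxl _ _) (hf i lt).
Qed.

(** The first colour is split off with enough connectivity left for the rest, whose degrees on [A]
    are again divisible by the remaining sum. The last colour is never split off, only left over,
    which is why it has no divisibility off [A]. *)
Lemma decomposition m lambda : exists f, decomposes m lambda f.
Proof.
elim/ltn_ind: m => m IHm.
have [|f0 hf0] := uniform_bound (P := fun i f => decomposes i lambda f) (n := m) _ IHm.
  by move=> i f f' le h b ms p e V E s t A F bip /(edge_conn_le le); exact: h.
have [||f1 hf1] := uniform_bound (n := m)
    (P := fun i f => 0 < i -> 0 < m - i -> splits i (m - i) (maxn lambda f0) f).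
- move=> i f f' le h i0 mi V E s t A F bip /(edge_conn_le le); exact: h.
- move=> i _; have [i0|i0] := posnP i; first by exists 0; rewrite i0.
  have [mi|mi] := posnP (m - i); first by exists 0; rewrite mi.
  by have [f hf] := bipartite_split (maxn lambda f0) i0 mi; exists f.
exists (maxn lambda f1) => -[|b] ms ms0 em V E s t A F bip Fconn Adiv.
  have eF i : [set e in F | (ord0 : 'I_1) == i] = F.
    by apply/setP=> e; rewrite inE [i]ord1 eqxx andbT.
  exists (fun=> ord0); split=> [i|]; first by rewrite eF; apply: edge_conn_le Fconn; apply: leq_maxl.
  split=> [i v _|i v _]; last by rewrite ltn0.
  by rewrite eF em big_ord1 [i]ord1 mulnC.
pose m1 := ms ord0; pose m2 := \sum_(i < b.+1) ms (lift ord0 i).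
have m2P : 0 < m2 by rewrite /m2 big_ord_recl; have := ms0 (lift ord0 ord0); case: (ms _).
have em12 : m = m1 + m2 by rewrite em big_ord_recl.
have em2 : m - m1 = m2 by rewrite em12 addKn.
have lt1 : m1 < m by rewrite em12 -[X in X < _]addn0 ltn_add2l.
have lt2 : m2 < m by rewrite em12 -[X in X < _]add0n ltn_add2r; exact: ms0.
have Fconn1 : edge_conn s t f1 F by apply: edge_conn_le Fconn; apply: leq_maxr.
have m12 : m1 + (m - m1) = m by rewrite em2.
have [||H [sH cH cFH dA dB]] := hf1 m1 lt1 (ms0 _) _ V E s t A F bip Fconn1.
- by rewrite em2.
- by move=> v vA; rewrite m12; exact: Adiv.
rewrite m12 in dA.
have degD v : deg s t (F :\: H) v + deg s t H v = deg s t F v.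
  rewrite /deg -(cardsID H [set e in F | incident s t e v]) addnC; congr (_ + _).
    apply: eq_card => e; rewrite !inE; have [eH|] := boolP (e \in H); last by rewrite andbF.
    by rewrite (subsetP sH) // andbT.
  by apply: eq_card => e; rewrite !inE; case: (e \in H); rewrite ?andbF.
have dA2 v : v \in A -> deg s t (F :\: H) v * m = m2 * deg s t F v.
  move=> vA; apply/eqP; rewrite -(eqn_add2r (deg s t H v * m)) -mulnDl degD dA //.
  by rewrite mulnC em12 mulnDl addnC.
have mP : 0 < m := leq_trans (ltn0Sn _) lt1.
have [|||c [c1 [c2 c3]]] := hf0 m2 lt2 b (fun i => ms (lift ord0 i)) _ erefl V E s t A (F :\: H) bip.
- by move=> i; exact: ms0.
- exact: edge_conn_le (leq_maxr _ _) cFH.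
- move=> v vA; have /dvdnP[q eq] := Adiv v vA; apply/dvdnP; exists q.
  apply/eqP; rewrite -(eqn_pmul2r mP) dA2 // eq; apply/eqP; ring.
have set0E : [set e in F | (if e \in H then ord0 else lift ord0 (c e)) == ord0] = H.
  apply/setP=> e; rewrite inE; have [eH|eH] := boolP (e \in H).
    by rewrite (subsetP sH).
  by rewrite eq_sym (negPf (neq_lift _ _)) andbF.
have setSE i : [set e in F | (if e \in H then ord0 else lift ord0 (c e)) == lift ord0 i] =
    [set e in F :\: H | c e == i].
  apply/setP=> e; rewrite !inE; have [eH|eH] := boolP (e \in H).
    by rewrite (negPf (neq_lift _ _)) andbF.
  by rewrite (inj_eq lift_inj).
exists (fun e => if e \in H then ord0 else lift ord0 (c e)); split=> [i|].
  case: (unliftP ord0 i) => [k|] ->; first by rewrite setSE.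
  by rewrite set0E; apply: edge_conn_le (leq_maxl _ _) cH.
split=> [i v vA|i v vA].
  case: (unliftP ord0 i) => [k|] ->; last by rewrite set0E dA.
  rewrite setSE; apply/eqP; rewrite -(eqn_pmul2r m2P); apply/eqP.
  by rewrite mulnAC (c2 k v vA) -mulnA dA2 // mulnA mulnAC.
case: (unliftP ord0 i) => [k|] ->; last by rewrite set0E => _; exact: dB.
by rewrite setSE => lt; apply: c3.
Qed.

Theorem theorem13 :
  forall m lambda : nat, exists f : nat,
  forall (b : nat) (ms : 'I_b.+1 -> nat),
    (forall i, 0 < ms i) -> m = \sum_(i < b.+1) ms i ->
  forall (V E : finType) (s t : E -> V) (A : {set V}),
    loopless s t ->
    bipartite_on s t A ->
    edge_conn s t f [set: E] ->
    (forall v, v \in A -> m %| deg s t [set: E] v) ->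
  exists c : E -> 'I_b.+1,
    (forall i, edge_conn s t lambda [set e | c e == i]) /\
    (forall i v, v \in A -> deg s t [set e | c e == i] v * m = ms i * deg s t [set: E] v) /\
    (forall (i : 'I_b.+1) v, v \notin A -> i < b -> ms i %| deg s t [set e | c e == i] v).
Proof.
move=> m lambda; have [f hf] := decomposition m lambda; exists f => b ms ms0 em V E s t A _ bip conn Adiv.
have [c hc] := hf b ms ms0 em V E s t A [set: E] bip conn Adiv; exists c.
have eT i : [set e | c e == i] = [set e in [set: E] | c e == i] by apply/setP=> e; rewrite !inE.
case: hc => c1 [c2 c3]; split=> [i|]; first by rewrite eT.
by split=> [i v|i v]; rewrite eT; [exact: c2 | exact: c3].
Qed.
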